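(* Let $\mathcal{L}$ be a Gorenstein* lattice (over the fixed field $\Bbbk$) and let $\overline{\mathcal{L}}$ be its proper part. Then $\overline{\mathcal{L}}$ is edgewise strongly Cohen--Macaulay, i.e. $\overline{\mathcal{L}}$ is Cohen--Macaulay and, for every closed interval $\mathcal{I}=[a,b]$ of $\overline{\mathcal{L}}$, the poset $\overline{\mathcal{L}}\ominus\mathcal{I}$ is Cohen--Macaulay of the same rank as $\overline{\mathcal{L}}$.
   Context: All posets are finite. Fix a field $\Bbbk$; homology is reduced simplicial homology $\widetilde H_*(\cdot,\Bbbk)$. A simplicial complex $\Delta$ is Cohen--Macaulay if $\widetilde H_i(\mathrm{lk}_\Delta(F),\Bbbk)=0$ for every face $F\in\Delta$ (including the empty face) and every $i<\dim \mathrm{lk}_\Delta(F)$, where $\mathrm{lk}_\Delta(F)=\{G\setminus F: F\subseteq G\in\Delta\}$; it is Gorenstein* if moreover $\widetilde H_i(\mathrm{lk}_\Delta(F),\Bbbk)\cong\Bbbk$ for every face $F$ and $i=\dim\mathrm{lk}_\Delta(F)$. The order complex $\Delta(\mathcal{P})$ of a poset $\mathcal{P}$ is the simplicial complex of its chains; $\mathcal{P}$ is called Cohen--Macaulay (resp. Gorenstein* ) if $\Delta(\mathcal{P})$ is. A poset is graded if all maximal chains have the same length (number of elements minus one), called its rank. A cover relation of $\mathcal{P}$ is a pair $(x,y)$ with $x<y$ and no $z$ with $x<z<y$; the Hasse diagram is the graph of cover relations. For a closed interval $\mathcal{I}=[a,b]=\{x: a\le x\le b\}$ of $\mathcal{P}$,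 $\mathcal{P}\ominus\mathcal{I}$ denotes the unique poset on the same ground set whose set of cover relations is the set of cover relations of $\mathcal{P}$ minus those cover relations $(x,y)$ with $x,y\in\mathcal{I}$ (i.e. the Hasse diagram with all edges inside $\mathcal{I}$ removed). A Cohen--Macaulay poset $\mathcal{P}$ is edgewise strongly Cohen--Macaulay if $\mathcal{P}\ominus\mathcal{I}$ is Cohen--Macaulay of the same rank as $\mathcal{P}$ for every closed interval $\mathcal{I}\subseteq\mathcal{P}$. The proper part $\overline{\mathcal{L}}$ of a finite lattice $\mathcal{L}$ is $\mathcal{L}$ with its minimum $\hat0$ and maximum $\hat1$ removed; $\mathcal{L}$ is called a Gorenstein* lattice if $\overline{\mathcal{L}}$ is a Gorenstein* poset. *)

(* Defs.v *)
From HB Require Import structures.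
From mathcomp Require Import all_boot all_order all_algebra.

Set Implicit Arguments.
Unset Strict Implicit.
Unset Printing Implicit Defensive.

Import Order.TTheory GRing.Theory Num.Theory.
Local Open Scope ring_scope.

(* Simplicial complexes are downward closed sets of faces X : {set {set T}}
   over a finite vertex type T; links and order complexes satisfy this.
   The empty face is a face of dimension -1, so degrees and dimensions are
   integers. *)

Section Complexes.
Variable T : finType.
Implicit Types (X : {set {set T}}) (F G : {set T}).

Definition is_complex X : Prop :=
  set0 \in X /\ forall F G, F \in X -> G \subset F -> G \in X.

Definition face_dim F : int := #|F|%:Z - 1.

(* Only meaningful for X != set0. *)
Definition complex_dim X : int := (\max_(F in X) #|F|)%:Z - 1.

Definition link X F : {set {set T}} := [set G :\: F | G in X & F \subset G].

Lemma link_is_complex X F : is_complex X -> F \in X -> is_complex (link X F).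
Proof.
move=> [_ Xd] XF; split.
  by apply/imsetP; exists F; rewrite ?inE ?XF ?subxx // setDv.
move=> _ G /imsetP[H /setIdP[XH sFH] ->] sG.
apply/imsetP; exists (F :|: G); last first.
  rewrite setDUl setDv set0U; apply/esym/setDidPl.
  by move: sG; rewrite subsetD => /andP[].
rewrite inE subsetUl andbT; apply: Xd XH _; rewrite subUset sFH.
by apply: subset_trans sG (subsetDl _ _).
Qed.

End Complexes.

Section Homology.
Variables (k : fieldType) (T : finType).
Implicit Types (X : {set {set T}}) (F G : {set T}).

(* All the chains on the full simplex over T, of all degrees together;
   [chains X i] is the space of the i-chains of X. *)
Definition chain := {ffun {set T} -> k^o}.

Definition simplex F : chain := [ffun G => (G == F)%:R].

(* Faces are oriented by the order of the enumeration of T. *)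
Definition position F (x : T) : nat :=
  #|[set y in F | (enum_rank y < enum_rank x)%N]|.

Definition bd_simplex F : chain :=
  \sum_(x in F) (-1) ^+ position F x *: simplex (F :\ x).

Definition bd (c : chain) : chain := \sum_F c F *: bd_simplex F.

Fact bd_is_linear : linear bd.
Proof.
move=> a c c'; rewrite /bd scaler_sumr -big_split; apply: eq_bigr => F _ /=.
by rewrite !ffunE scalerDl scalerA.
Qed.
HB.instance Definition _ :=
  GRing.isLinear.Build k chain chain _ bd bd_is_linear.

Definition chains X (i : int) : {vspace chain} :=
  <<[seq simplex F | F in [set G in X | face_dim G == i]]>>%VS.

Definition cycles X (i : int) : {vspace chain} :=
  (chains X i :&: lker (linfun bd))%VS.

Definition boundaries X (i : int) : {vspace chain} :=
  (linfun bd @: chains X (i + 1))%VS.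

(* The quotient of the i-cycles by the i-boundaries, realised as a complement
   of [boundaries X i] in [cycles X i]; see [boundaries_sub_cycles]. *)
Definition homology X (i : int) : {vspace chain} :=
  (cycles X i :\: boundaries X i)%VS.

Lemma bd_simplexE F : bd (simplex F) = bd_simplex F.
Proof.
rewrite /bd (bigD1 F) //= ffunE eqxx scale1r big1 ?addr0 // => G neqGF.
by rewrite ffunE (negbTE neqGF) scale0r.
Qed.

Lemma bd_bd_simplex F : bd (bd_simplex F) = 0.
Proof.
rewrite [bd_simplex F]/bd_simplex linear_sum /=.
under eq_bigr => x _ do rewrite linearZ /= bd_simplexE scaler_sumr.
pose t x y : chain := (-1) ^+ position F x *:
  ((-1) ^+ position (F :\ x) y *: simplex (F :\ x :\ y)).
have lt_rank x y : y != x ->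
    (enum_rank y < enum_rank x)%N = ~~ (enum_rank x < enum_rank y)%N.
  move=> neqyx; rewrite -leqNgt ltn_neqAle (inj_eq val_inj).
  by rewrite (inj_eq enum_rank_inj) neqyx.
transitivity (\sum_(x in F)
    (\sum_(y in F | (enum_rank y < enum_rank x)%N) t x y
   + \sum_(y in F | (enum_rank x < enum_rank y)%N) t x y)).
  apply: eq_bigr => x xF.
  rewrite (bigID (fun y => (enum_rank y < enum_rank x)%N)) /=.
  by congr (_ + _); apply: eq_bigl => y; rewrite !inE;
    have [->|/lt_rank ->] := eqVneq y x; rewrite ?ltnn ?andbF ?negbK.
rewrite big_split /= [X in _ + X](exchange_big_dep (mem F)) /=; last first.
  by move=> x y _ /andP[].
rewrite -big_split /=; apply: big1 => x xF.
rewrite [X in _ + X](eq_bigl (fun y => (y \in F) && (enum_rank y < enum_rank x)%N));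
  last by move=> y; rewrite xF.
rewrite -big_split /=; apply: big1 => y /andP[yF ltyx]; rewrite /t !scalerA.
have -> : F :\ x :\ y = F :\ y :\ x.
  by apply/setP=> z; rewrite !inE; do 2!case: (_ == _).
rewrite -scalerDl -!exprD.
have -> : position (F :\ x) y = position F y.
  congr #|pred_of_set _|; apply/setP => z; rewrite !inE.
  case: (z =P x) => //= ->; by rewrite ltnNge (ltnW ltyx) !andbF.
have -> : position F x = (position (F :\ y) x).+1.
  rewrite /position (cardsD1 y) !inE yF ltyx add1n; congr _.+1.
  by congr #|pred_of_set _|; apply/setP => z; rewrite !inE andbA.
by rewrite addSn exprS mulN1r addnC addNr scale0r.
Qed.

Lemma bd_bd c : bd (bd c) = 0.
Proof.
rewrite {2}/bd linear_sum /=; apply: big1 => F _.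
by rewrite linearZ /= bd_bd_simplex scaler0.
Qed.

Lemma boundaries_sub_cycles X i :
  is_complex X -> (boundaries X i <= cycles X i)%VS.
Proof.
move=> [_ Xd]; rewrite /boundaries limg_span; apply/span_subvP => v.
case/mapP=> _ /imageP[F /setIdP[XF /eqP dF] ->] ->.
rewrite lfunE /= bd_simplexE memv_cap memv_ker lfunE /= bd_bd_simplex eqxx andbT.
apply: memv_suml => x xF; apply/memvZ/memv_span/image_f.
rewrite inE (Xd F) ?subsetDl //=; move: dF; rewrite /face_dim (cardsD1 x F) xF.
by rewrite PoszD -addrA addrC => /addIr <-.
Qed.

Definition lin_iso (U V : vectType k) : Prop :=
  exists f : {linear U -> V}, bijective f.

Definition CM_complex X : Prop :=
  forall F, F \in X ->
  forall i : int, i < complex_dim (link X F) -> homology (link X F) i = 0%VS.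

Definition Gorenstein_star_complex X : Prop :=
  CM_complex X /\
  forall F, F \in X ->
    lin_iso (subvs_of (homology (link X F) (complex_dim (link X F)))) k^o.

End Homology.

Section Posets.
Variables (d : Order.disp_t) (P : finPOrderType d).
Implicit Types (x y : P) (C I : {set P}).

Definition order_complex : {set {set P}} :=
  [set C : {set P} | [forall x in C, forall y in C, (x >=< y)%O]].

Lemma order_complex_is_complex : is_complex order_complex.
Proof.
split=> [|C D]; rewrite !inE.
  by apply/forall_inP => x; rewrite inE.
move=> /forall_inP chC /subsetP sDC; apply/forall_inP => x /sDC /chC /forall_inP Cx.
by apply/forall_inP => y /sDC /Cx.
Qed.

Definition maximal_chain C : bool := maxset [in order_complex] C.

(* P is graded and its rank is r; the rank of the empty poset is -1. *)
Definition graded_of_rank (r : int) : Prop :=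
  forall C, maximal_chain C -> #|C|%:Z - 1 = r.

Definition covers x y : bool :=
  (x < y)%O && [forall z, ~~ ((x < z)%O && (z < y)%O)].

Definition closed_interval (a b : P) : {set P} :=
  [set x | (a <= x)%O && (x <= b)%O].

Definition CM_poset (k : fieldType) : Prop := CM_complex k order_complex.

Definition Gorenstein_star_poset (k : fieldType) : Prop :=
  Gorenstein_star_complex k order_complex.

(* The cover relations that remain when those inside I are removed. *)
Definition ominus_covers I x y : bool :=
  covers x y && ~~ ((x \in I) && (y \in I)).

Definition ominus_le I : rel P := connect (ominus_covers I).

Lemma ominus_le_le I x y : ominus_le I x y -> (x <= y)%O.
Proof.
move=> /connectP[p]; elim: p x => [|z p IHp] x /=; first by move=> _ ->.
case/andP=> /andP[/andP[/ltW lexz _] _] pz y_last.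
exact: le_trans lexz (IHp z pz y_last).
Qed.

Fact ominus_le_anti I : antisymmetric (ominus_le I).
Proof.
by move=> x y /andP[/ominus_le_le lexy /ominus_le_le leyx]; apply: le_anti; rewrite lexy.
Qed.

End Posets.

(* P minus the edges of its Hasse diagram that lie inside I: the ground set of
   P with the order generated by the remaining cover relations; by
   [covers_ominus] these are exactly the cover relations of the new order, and
   by [ominus_unique] no other order has them. *)
Definition ominus d (P : finPOrderType d) (I : {set P}) : Type := P.

HB.instance Definition _ d (P : finPOrderType d) (I : {set P}) :=
  Finite.on (ominus I).
HB.instance Definition _ d (P : finPOrderType d) (I : {set P}) :=
  Order.Le_isPOrder.Build d (ominus I) (@connect0 _ (ominus_covers I))
    (@ominus_le_anti d P I) (@connect_trans _ (ominus_covers I)).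

Lemma covers_connect d (P : finPOrderType d) (x y : P) :
  (x <= y)%O = connect (@covers d P) x y.
Proof.
apply/idP/idP; last first.
  move=> /connectP[p]; elim: p x => [|z p IHp] x /=; first by move=> _ ->.
  case/andP=> /andP[/ltW lexz _] pz y_last.
  exact: le_trans lexz (IHp z pz y_last).
have [n] := ubnP #|[set z | (x <= z <= y)%O]|.
elim: n x y => // n IHn x y ltn; rewrite le_eqVlt => /predU1P[->|ltxy].
  exact: connect0.
have [cxy|] := boolP (covers x y); first exact: connect1.
rewrite /covers ltxy /= negb_forall => /existsP[z]; rewrite negbK => /andP[xz zy].
apply: (@connect_trans _ _ z); apply: IHn (ltW _) => //;
  apply: leq_trans (proper_card _) ltn; apply/properP; split.
- by apply/subsetP=> t; rewrite !inE => /andP[-> /le_trans->] //; apply: ltW.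
- by exists y; rewrite !inE ?lexx ?(ltW ltxy) // lt_geF ?andbF.
- apply/subsetP=> t; rewrite !inE => /andP[zt ->]; rewrite andbT.
  exact: le_trans (ltW xz) zt.
- by exists x; rewrite !inE ?lexx ?(ltW ltxy) // lt_geF.
Qed.

Lemma covers_ominus d (P : finPOrderType d) (I : {set P}) (x y : P) :
  covers (x : ominus I) (y : ominus I) =
  covers x y && ~~ ((x \in I) && (y \in I)).
Proof.
have ltP (u v : P) : ((u : ominus I) < (v : ominus I))%O -> (u < v)%O.
  rewrite !lt_neqAle => /andP[neq /ominus_le_le ->]; by rewrite andbT.
apply/idP/idP; last first.
  move=> oc; have /andP[/andP[ltxy /forallP no] _] := oc.
  apply/andP; split.
    rewrite lt_neqAle; apply/andP; split; last exact: connect1.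
    by rewrite (lt_eqF ltxy).
  apply/forallP=> z; apply: contra (no z) => /andP[/ltP -> /ltP ->] //.
case/andP=> ltxy /forallP no.
have: ominus_le I x y by exact: ltW ltxy.
case/connectP=> -[|z p] /=; first by move=> _ eyx; rewrite eyx ltxx in ltxy.
case/andP=> xz pz ey; have lexz := connect1 xz.
suff -> : y = z by [].
have lezy : ominus_le I z y by apply/connectP; exists p.
have := no z; rewrite negb_and; case/orP.
  rewrite lt_neqAle negb_and; case/orP; last by case/negP.
  by rewrite negbK => /eqP exz; case/andP: xz => /andP[]; rewrite exz ltxx.
rewrite lt_neqAle negb_and; case/orP; last by case/negP.
by rewrite negbK => /eqP.
Qed.

Lemma ominus_unique d (P : finPOrderType d) (I : {set P})
    d' (Q : finPOrderType d') (f : P -> Q) :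
    bijective f ->
    (forall x y : P, covers (f x) (f y) =
                     covers x y && ~~ ((x \in I) && (y \in I))) ->
  forall x y : P, (f x <= f y)%O = ((x : ominus I) <= (y : ominus I))%O.
Proof.
move=> [g fK gK] cf x y; rewrite covers_connect.
have -> : ((x : ominus I) <= (y : ominus I))%O = connect (ominus_covers I) x y by [].
apply/connectP/connectP=> -[p pp ey].
  exists (map g p); last by rewrite -(fK x) last_map -ey fK.
  rewrite -(fK x) path_map; apply: sub_path pp => u v.
  by rewrite /= /ominus_covers -cf !gK.
exists (map f p); last by rewrite last_map -ey.
by rewrite path_map; apply: sub_path pp => u v; rewrite /= cf.
Qed.

Definition edgewise_strongly_CM (k : fieldType) d (P : finPOrderType d) : Prop :=
  CM_poset P k /\
  exists2 r : int, graded_of_rank P r &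
    forall a b : P,
      CM_poset (ominus (closed_interval a b)) k /\
      graded_of_rank (ominus (closed_interval a b)) r.

Definition proper_part d (L : finTBLatticeType d) : Type :=
  {x : L | (x != \bot%O) && (x != \top%O)}.

HB.instance Definition _ d (L : finTBLatticeType d) :=
  SubFinite.on (proper_part L).
HB.instance Definition _ d (L : finTBLatticeType d) :=
  [SubChoice_isSubPOrder of proper_part L by <: with d].

Definition Gorenstein_star_lattice (k : fieldType) d (L : finTBLatticeType d) :
  Prop := Gorenstein_star_poset (proper_part L) k.

(* Main.v *)
Require Import Defs.
From HB Require Import structures.
From mathcomp Require Import all_boot all_order all_algebra.

(* In a Gorenstein* lattice y is the join of the atoms of [x, y], since
   otherwise the open interval would be contractible.  Hence, if x < y and
   exactly one of x, y lies in I = [a, b], then x is still below y after the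
   edges inside I are removed, and the chains of P - I (P the proper part) are
   the chains of P with at most one element in I.  Let K be the link in P of
   such a chain F.  The elements of I comparable with all of F have a minimum
   and a maximum, so the part J of K inside I is empty or a cone.  Deleting a
   vertex from a homology sphere leaves an acyclic complex, and by
   Mayer-Vietoris, removing the remaining vertices of the cone J one by one,
   K \ J is acyclic.  The link of F in P - I is either K, or K \ J, or K \ J
   with a cone over an acyclic complex glued in for each vertex of J; in the
   last two cases it is acyclic. *)

Set Implicit Arguments.
Unset Strict Implicit.
Unset Printing Implicit Defensive.

Import Order.TTheory GRing.Theory Num.Theory.
Local Open Scope ring_scope.

(** * Chains as an exterior algebra, with cones as contracting homotopies *)

Section ExteriorAlgebra.
Variables (k : fieldType) (T : finType).
Implicit Types (c z e : chain k T) (G F : {set T}) (x y v w : T).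

Definition sgn v G : k := (-1) ^+ position G v.

Lemma sgn_sqr v G : sgn v G * sgn v G = 1.
Proof. by rewrite /sgn -expr2 sqrr_sign. Qed.

Lemma position_setU1 v G : position (v |: G) v = position G v.
Proof.
congr #|pred_of_set _|; apply/setP => y; rewrite !inE.
by case: eqVneq => // ->; rewrite ltnn !andbF.
Qed.

Lemma position_setD1 v G : position (G :\ v) v = position G v.
Proof.
congr #|pred_of_set _|; apply/setP => y; rewrite !inE.
by case: eqVneq => // ->; rewrite ltnn !andbF.
Qed.

Lemma sgn_setU1 v G : sgn v (v |: G) = sgn v G.
Proof. by rewrite /sgn position_setU1. Qed.

Lemma sgn_setD1 v G : sgn v (G :\ v) = sgn v G.
Proof. by rewrite /sgn position_setD1. Qed.

Lemma sgn_add v w G : w \notin G ->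
  sgn v (w |: G) = (-1) ^+ (enum_rank w < enum_rank v)%N * sgn v G.
Proof.
move=> wG; rewrite /sgn -exprD; congr (_ ^+ _).
rewrite /position; have [lt|nlt] := boolP (enum_rank w < enum_rank v)%N.
  rewrite (cardsD1 w) !inE eqxx lt /=; congr (_ + _)%N.
  congr #|pred_of_set _|; apply/setP => y; rewrite !inE.
  by case: eqVneq => //= ->; rewrite (negbTE wG).
congr #|pred_of_set _|; apply/setP => y; rewrite !inE.
by case: eqVneq => //= ->; rewrite (negbTE wG) (negbTE nlt).
Qed.

(** Exactly one of [x], [y] precedes the other, so exactly one of the two insertions flips a sign.
    The anticommutation rules for distinct vertices rest on this. *)
Lemma sgn_swap x y G : x != y -> x \notin G -> y \notin G ->
  sgn x G * sgn y (x |: G) = - (sgn y G * sgn x (y |: G)).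
Proof.
move=> nxy xG yG; rewrite !sgn_add //.
have : (enum_rank x < enum_rank y)%N = ~~ (enum_rank y < enum_rank x)%N.
  by rewrite -leqNgt ltn_neqAle (inj_eq val_inj) (inj_eq enum_rank_inj) nxy.
move=> ->; case: (_ < _)%N; rewrite /= ?expr0 ?expr1 !mul1r !mulN1r.
  by rewrite mulrN opprK mulrC.
by rewrite mulrN mulrC.
Qed.

(* With [bd] the sum of all contractions, [contract] and [cone] are the
   interior and exterior products of the exterior algebra on T. *)
Definition contract v c : chain k T :=
  [ffun G : {set T} => if v \in G then 0 else sgn v G * c (v |: G)].

Definition cone v c : chain k T :=
  [ffun G : {set T} => if v \in G then sgn v G * c (G :\ v) else 0].

Fact contract_is_linear v : linear (contract v).
Proof.
move=> a c e; apply/ffunP => G; rewrite !ffunE; case: ifP => _.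
  by rewrite scaler0 addr0.
by rewrite mulrDr /GRing.scale /= mulrCA.
Qed.
HB.instance Definition _ v :=
  GRing.isLinear.Build k (chain k T) (chain k T) _ (contract v)
    (contract_is_linear v).

Fact cone_is_linear v : linear (cone v).
Proof.
move=> a c e; apply/ffunP => G; rewrite !ffunE; case: ifP => _.
  by rewrite mulrDr /GRing.scale /= mulrCA.
by rewrite scaler0 addr0.
Qed.
HB.instance Definition _ v :=
  GRing.isLinear.Build k (chain k T) (chain k T) _ (cone v) (cone_is_linear v).

Lemma bdE c G : bd c G = \sum_(v | v \notin G) sgn v G * c (v |: G).
Proof.
rewrite /bd sum_ffunE.
transitivity (\sum_(F : {set T}) \sum_(v : T)
    (if (v \in F) && (F :\ v == G) then sgn v G * c F else 0)).
  apply: eq_bigr => F _; rewrite !ffunE sum_ffunE scaler_sumr [LHS]big_mkcond.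
  apply: eq_bigr => v _; case: ifP => //= vF; rewrite !ffunE (eq_sym G).
  case: eqP => [<-|_]; last by rewrite !scaler0.
  by rewrite sgn_setD1 /GRing.scale /= mulr1 mulrC.
rewrite exchange_big /= [RHS]big_mkcond; apply: eq_bigr => v _.
have [vG|vG] := boolP (v \in G) => /=.
  apply: big1 => F _; case: ifP => // /andP[_ /eqP eG].
  by move: vG; rewrite -eG !inE eqxx.
rewrite (bigD1 (v |: G)) //= setU11 setU1K // eqxx /= big1 ?addr0 // => F nF.
case: ifP => // /andP[vF /eqP eG].
by case/eqP: nF; rewrite -eG setD1K.
Qed.

Lemma bd_contract_sum c : bd c = \sum_v contract v c.
Proof.
apply/ffunP => G; rewrite bdE sum_ffunE big_mkcond.
by apply: eq_bigr => v _; rewrite ffunE; case: (v \in G).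
Qed.

Lemma contractC x y c : contract x (contract y c) = - contract y (contract x c).
Proof.
apply/ffunP => G; rewrite !ffunE !inE; have [->|nxy] := eqVneq x y.
  by case: ifP => _; rewrite ?eqxx /= ?mulr0 oppr0.
have [xG|xG] := boolP (x \in G).
  by case: ifP => _; rewrite ?mulr0 oppr0.
have [yG|yG] := boolP (y \in G); first by rewrite mulr0 oppr0.
by rewrite !mulrA sgn_swap // setUCA mulNr.
Qed.

Lemma contract_cone_neq x y c : x != y ->
  contract x (cone y c) = - cone y (contract x c).
Proof.
move=> nxy; apply/ffunP => G; rewrite !ffunE !inE (negbTE nxy) eq_sym (negbTE nxy) /=.
have [xG|xG] := boolP (x \in G).
  by case: ifP => _; rewrite ?mulr0 oppr0.
have [yG|yG] := boolP (y \in G); last by rewrite mulr0 oppr0.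
have hs : (x |: G) :\ y = x |: (G :\ y).
  by apply/setP => t; rewrite !inE; case: eqVneq => [->|]; case: eqVneq => // e;
    rewrite e eqxx in nxy.
have nyx : y != x by rewrite eq_sym.
have xGy : x \notin G :\ y by rewrite !inE negb_and xG orbT.
have yGy : y \notin G :\ y by rewrite !inE eqxx.
have := sgn_swap nyx yGy xGy; rewrite setD1K // sgn_setD1 => E.
have : sgn y G * sgn x (G :\ y) = - (sgn x G * sgn y (x |: G)).
  have e1 : sgn y (x |: G) = sgn y (x |: (G :\ y)) by rewrite -hs sgn_setD1.
  have e2 : sgn x G = (-1) ^+ (enum_rank y < enum_rank x)%N * sgn x (G :\ y).
    by rewrite -sgn_add // setD1K.
  move: E; rewrite -e1 e2; case: (_ < _)%N; rewrite /= ?expr0 ?expr1 ?mul1r ?mulN1r //.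
  by rewrite mulrN mulNr => /oppr_inj ->; rewrite opprK.
by move=> E'; rewrite hs !mulrA E' mulNr opprK.
Qed.

Lemma contract_cone v c : contract v (cone v c) + cone v (contract v c) = c.
Proof.
apply/ffunP => G; rewrite !ffunE !inE !eqxx /=.
case: ifP => vG; rewrite ?add0r ?addr0.
  by rewrite sgn_setD1 mulrA sgn_sqr mul1r setD1K.
by rewrite sgn_setU1 mulrA sgn_sqr mul1r setU1K ?vG.
Qed.

Lemma bd_contract v c : bd (contract v c) = - contract v (bd c).
Proof.
rewrite !bd_contract_sum linear_sum /= -sumrN.
by apply: eq_bigr => w _; rewrite contractC.
Qed.

(** [cone v] is a contracting homotopy: in the sum of contractions the term at [v] contributes the
    identity by [contract_cone], and the others anticommute with [cone v]. *)
Lemma bd_cone v c : bd (cone v c) = c - cone v (bd c).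
Proof.
rewrite !bd_contract_sum linear_sum /= (bigD1 v) //= [in RHS](bigD1 v) //=.
have -> : contract v (cone v c) = c - cone v (contract v c).
  by apply/eqP; rewrite -subr_eq0 opprB addrA contract_cone subrr.
rewrite opprD addrA -sumrN; congr (_ + _).
by apply: eq_bigr => w nwv; rewrite contract_cone_neq.
Qed.
End ExteriorAlgebra.

(** * Acyclic complexes and Mayer-Vietoris *)

Section Subcomplexes.
Variable T : finType.
Implicit Types (X Y : {set {set T}}) (F G J : {set T}) (v w x y : T).

Definition deletion X J : {set {set T}} := [set G in X | [disjoint G & J]].

Definition card_facets X : nat := \max_(F in X) #|F|.

Lemma in_link X F G : (G \in link X F) = [disjoint G & F] && (F :|: G \in X).
Proof.
apply/imsetP/andP => [[H /setIdP[XH sFH] ->]|[dis XFG]].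
  by rewrite disjoints_subset setDE subsetIr setUIr setUCr setIT (setUidPr sFH).
exists (F :|: G); first by rewrite inE XFG subsetUl.
by rewrite setDUl setDv set0U; apply/esym/setDidPl.
Qed.

Lemma in_link1 X v G : (G \in link X [set v]) = (v \notin G) && (v |: G \in X).
Proof. by rewrite in_link disjoint_sym disjoints1. Qed.

Lemma link0 X : link X set0 = X.
Proof. by apply/setP => G; rewrite in_link disjoints_subset setC0 subsetT set0U. Qed.

Lemma link_link X F G : [disjoint G & F] ->
  link (link X F) G = link X (F :|: G).
Proof.
rewrite -setI_eq0 => /eqP dGF; apply/setP => H; rewrite !in_link -!setI_eq0.
by rewrite setIUl setIUr dGF set0U setU_eq0 setUA andbA [(_ == set0) && _]andbC.
Qed.

Lemma sub_link X F : is_complex X -> link X F \subset X.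
Proof.
move=> [_ Xd]; apply/subsetP => G; rewrite in_link => /andP[_ /Xd]; apply.
exact: subsetUr.
Qed.

Lemma deletion_is_complex X J : is_complex X -> is_complex (deletion X J).
Proof.
move=> [X0 Xd]; split=> [|F G]; first by rewrite inE X0 disjoints_subset sub0set.
rewrite !inE => /andP[XF dF] sGF.
by rewrite (Xd F) //=; apply: disjointWl dF.
Qed.

Lemma in_deletion1 X v G : (G \in deletion X [set v]) = (G \in X) && (v \notin G).
Proof. by rewrite inE disjoint_sym disjoints1. Qed.

Lemma card_facets_ge X F : F \in X -> (#|F| <= card_facets X)%N.
Proof. by move=> XF; rewrite /card_facets (bigD1 F) //= leq_maxl. Qed.

Lemma card_facets_ex X : is_complex X -> exists2 F, F \in X & #|F| = card_facets X.
Proof.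
move=> [X0 _]; have : (0 < #|X|)%N by apply/card_gt0P; exists set0.
by move=> /(eq_bigmax_cond (fun F : {set T} => #|F|))[F XF e]; exists F;
  rewrite // /card_facets e.
Qed.

Lemma card_facets_link1 X v : is_complex X -> [set v] \in X ->
  (card_facets (link X [set v]) < card_facets X)%N.
Proof.
move=> cX Xv; have [F] := card_facets_ex (link_is_complex cX Xv).
rewrite in_link1 => /andP[vF XvF] <-.
by apply: leq_trans (card_facets_ge XvF); rewrite cardsU1 vF.
Qed.
End Subcomplexes.

Section Acyclicity.
Variables (k : fieldType) (T : finType).
Implicit Types (X Y : {set {set T}}) (F G J : {set T}) (v w x y : T).
Implicit Types (c e z : chain k T).

(* Chains are graded by the number m of vertices, so that m = 0 is the reduced
   degree -1. *)
Definition chain_of X m c : Prop :=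
  forall G, c G != 0 -> (G \in X) && (#|G| == m).

Definition exact_at X m : Prop :=
  forall z, chain_of X m z -> bd z = 0 -> exists2 e, chain_of X m.+1 e & bd e = z.

(** As m = 0 is included, the complex whose only face is empty is not acyclic, but the void set of
    faces is. *)
Definition acyclic X : Prop := forall m, exact_at X m.

Lemma chain_ofD X m c e : chain_of X m c -> chain_of X m e -> chain_of X m (c + e).
Proof.
move=> Xc Xe G; rewrite ffunE; have [->|/Xc //] := eqVneq (c G) 0.
by rewrite add0r => /Xe.
Qed.

Lemma chain_ofZ X m a c : chain_of X m c -> chain_of X m (a *: c).
Proof.
move=> Xc G; rewrite ffunE; have [->|/Xc //] := eqVneq (c G) 0.
by rewrite scaler0 eqxx.
Qed.

Lemma chain_ofN X m c : chain_of X m c -> chain_of X m (- c).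
Proof. by rewrite -scaleN1r; apply: chain_ofZ. Qed.

Lemma chain_ofB X m c e : chain_of X m c -> chain_of X m e -> chain_of X m (c - e).
Proof. by move=> Xc /chain_ofN; apply: chain_ofD. Qed.

Lemma chain_of0 X m : chain_of X m 0.
Proof. by move=> G; rewrite ffunE eqxx. Qed.

Lemma chain_of_sub X Y m c : X \subset Y -> chain_of X m c -> chain_of Y m c.
Proof. by move=> sXY Xc G /Xc /andP[/(subsetP sXY) -> ->]. Qed.

(** For m = 0 the contraction is 0, so the truncated predecessor does no harm. *)
Lemma chain_of_contract X m v c : chain_of X m c ->
  chain_of (link X [set v]) m.-1 (contract v c).
Proof.
move=> Xc G; rewrite ffunE in_link1; case: ifP => vG; first by rewrite eqxx.
rewrite mulf_eq0 negb_or => /andP[_ /Xc /andP[-> /eqP <-]].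
by rewrite cardsU1 vG eqxx.
Qed.

Lemma chain_of_cone X m v c : (forall G, G \in X -> v |: G \in X) ->
  chain_of X m c -> chain_of X m.+1 (cone v c).
Proof.
move=> Xv Xc G; rewrite ffunE; case: ifP => vG; last by rewrite eqxx.
rewrite mulf_eq0 negb_or => /andP[_ /Xc /andP[/Xv]].
by rewrite setD1K // => -> /eqP <-; rewrite [in X in X == _](cardsD1 v) vG /= add1n eqxx.
Qed.

Lemma chain_of_cone_link X m v c : chain_of (link X [set v]) m c ->
  chain_of X m.+1 (cone v c).
Proof.
move=> Xc G; rewrite ffunE; case: ifP => vG; last by rewrite eqxx.
rewrite mulf_eq0 negb_or => /andP[_ /Xc]; rewrite in_link1 => /andP[/andP[_]].
by rewrite setD1K // => -> /eqP <-; rewrite [in X in X == _](cardsD1 v) vG /= add1n eqxx.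
Qed.

Lemma chain_of_del X m v c : chain_of X m c -> contract v c = 0 ->
  chain_of (deletion X [set v]) m c.
Proof.
move=> Xc c0 G cG; rewrite in_deletion1; have /andP[-> ->] := Xc _ cG.
rewrite andbT /=; apply/negP => vG; move/ffunP: c0 => /(_ (G :\ v)).
rewrite !ffunE !inE eqxx /= setD1K // => /eqP; rewrite mulf_eq0 (negbTE cG) orbF.
by rewrite /sgn signr_eq0.
Qed.

Lemma contract0P v c : (forall G, c G != 0 -> v \notin G) -> contract v c = 0.
Proof.
move=> vc; apply/ffunP => G; rewrite !ffunE; case: ifP => // vG.
have [->|/vc] := eqVneq (c (v |: G)) 0; first by rewrite mulr0.
by rewrite setU11.
Qed.

Lemma contract_link X m v c : chain_of (link X [set v]) m c -> contract v c = 0.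
Proof. by move=> Xc; apply: contract0P => G /Xc; rewrite in_link1 => /andP[/andP[]]. Qed.

Lemma chain_of_deletion X m v c : chain_of (deletion X [set v]) m c ->
  chain_of X m c /\ contract v c = 0.
Proof.
move=> Xc; split; first by apply: chain_of_sub Xc; apply/subsetP => G; rewrite inE => /andP[].
by apply: contract0P => G /Xc; rewrite in_deletion1 => /andP[/andP[]].
Qed.

Lemma contract_contract v c : contract v (contract v c) = 0.
Proof. by apply: contract0P => G; rewrite ffunE; case: ifP => // _; rewrite eqxx. Qed.

(* A chain whose part through v bounds in the link of v can be pushed off v. *)
Lemma push_off X m v c e : is_complex X -> chain_of X m c ->
    chain_of (link X [set v]) m e -> bd e = contract v c ->
  chain_of (deletion X [set v]) m (c + bd (cone v e)).
Proof.
(* The added boundary is [e - cone v (contract v c)]: its second term cancels the faces of [c]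
   through [v], and [e] avoids [v]. *)
move=> cX Xc Xe ebd; rewrite bd_cone ebd; apply: chain_of_del; last first.
  rewrite !raddfD /= raddfN /=.
  have := contract_cone v (contract v c); rewrite contract_contract raddf0 addr0 => ->.
  by rewrite (contract_link Xe) add0r subrr.
apply: chain_ofD => //; apply: chain_ofB.
  by apply: chain_of_sub Xe; apply: sub_link.
case: m Xc {Xe} => [|m] Xc; last exact: chain_of_cone_link (chain_of_contract Xc).
rewrite (_ : contract v c = 0) ?raddf0; first exact: chain_of0.
by apply: contract0P => G /Xc; rewrite cards_eq0 => /andP[_ /eqP->]; rewrite inE.
Qed.

(** X is the deletion of [v] with a cone over the link glued in. The contraction of a cycle at [v]
    bounds in the link, so the cycle can be pushed off [v] and filled in the deletion. *)
Lemma acyclic_of_deletion X v : is_complex X ->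
  acyclic (deletion X [set v]) -> acyclic (link X [set v]) -> acyclic X.
Proof.
move=> cX aD aL m z Xz zcyc.
have [e Xe ebd] : exists2 e, chain_of (link X [set v]) m e & bd e = contract v z.
  case: m Xz => [|m] Xz.
    exists 0; rewrite ?raddf0; first exact: chain_of0.
    by apply/esym/contract0P => G /Xz; rewrite cards_eq0 => /andP[_ /eqP->]; rewrite inE.
  apply: aL; first exact: chain_of_contract Xz.
  by rewrite bd_contract zcyc raddf0 oppr0.
have Dz := push_off cX Xz Xe ebd.
have [|c Xc cbd] := aD _ _ Dz; first by rewrite raddfD /= bd_bd addr0.
exists (c - cone v e); last by rewrite raddfB /= cbd addrK.
apply: chain_ofB; first by case: (chain_of_deletion Xc).
exact: chain_of_cone_link Xe.
Qed.

Lemma bounds_in_deletion X m v c e : is_complex X -> chain_of X m c ->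
    chain_of (link X [set v]) m e -> bd e = contract v c ->
  exists2 c', chain_of (deletion X [set v]) m c' & bd c' = bd c.
Proof.
move=> cX Xc Xe ebd; exists (c + bd (cone v e)); first exact: push_off ebd.
by rewrite raddfD /= bd_bd addr0.
Qed.

(** Fill the cycle in [X]. Since the cycle avoids [v], the contraction of the filling is a cycle of
    the link, so the filling can be pushed off [v] with its boundary unchanged. *)
Lemma acyclic_deletion X v : is_complex X ->
  acyclic X -> acyclic (link X [set v]) -> acyclic (deletion X [set v]).
Proof.
move=> cX aX aL m z /chain_of_deletion[Xz z0] zcyc.
have [c Xc cbd] := aX m z Xz zcyc.
have [|e Xe ebd] := aL m (contract v c) (chain_of_contract Xc).
  by rewrite bd_contract cbd z0 oppr0.
by rewrite -cbd; apply: bounds_in_deletion ebd.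
Qed.

Lemma acyclic_cone X v : (forall G, G \in X -> v |: G \in X) -> acyclic X.
Proof.
move=> Xv m z Xz zcyc; exists (cone v z); first exact: chain_of_cone.
by rewrite bd_cone zcyc raddf0 subr0.
Qed.
End Acyclicity.

(** * Cohen-Macaulay and Gorenstein* complexes *)

Section CohenMacaulay.
Variables (k : fieldType) (T : finType).
Implicit Types (X Y : {set {set T}}) (F G J : {set T}) (v w x y : T).
Implicit Types (c e z : chain k T).

Lemma bd_simplex1 v : bd_simplex k [set v] = simplex k set0.
Proof.
rewrite /bd_simplex big_set1 setDv (_ : position _ _ = 0%N) ?scale1r //.
by apply: eq_card0 => y; rewrite !inE; case: eqVneq => // ->; rewrite ltnn.
Qed.

(* The restriction of a 1-chain to the vertices where f holds has a boundary
   whose coefficients sum to 0. *)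
Lemma connected_of_exact X (f : pred T) : exact_at k X 1 ->
    (forall x y, x != y -> [set x; y] \in X -> f x = f y) ->
  forall v w, [set v] \in X -> [set w] \in X -> f v = f w.
Proof.
move=> ex fX v w Xv Xw; have [->//|nvw] := eqVneq v w.
pose c : chain k T := simplex k [set v] - simplex k [set w].
have [||e Xe ebd] := ex c.
- move=> G; rewrite !ffunE.
  case: (G =P [set v]) => [->|_]; first by rewrite Xv cards1.
  case: (G =P [set w]) => [->|_]; first by rewrite Xw cards1.
  by rewrite subrr eqxx.
- by rewrite raddfB /= !bd_simplexE !bd_simplex1 subrr.
(* No edge of [X] joins a vertex satisfying [f] to one that does not, so the boundary of [e'] is the
   part of [c] where [f] holds. *)
pose e' : chain k T := [ffun G : {set T} => if [forall x in G, f x] then e G else 0].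
have /ffunP/(_ set0) := bd_bd e'; rewrite bdE ffunE.
have pick (x : T) : bd e' (x |: set0) = if f x then c [set x] else 0.
  rewrite setU0 bdE -ebd bdE; case: ifP => fx; last first.
    apply: big1 => y _; rewrite ffunE; case: ifP => [|_]; last by rewrite mulr0.
    by move=> /forall_inP/(_ x); rewrite !inE eqxx orbT fx => /(_ isT).
  apply: eq_bigr => y yx; rewrite ffunE; case: ifP => // nf.
  have [->//|/Xe /andP[Xyx _]] := eqVneq (e (y |: [set x])) 0.
  case/forall_inP: nf => t; rewrite !inE => /orP[/eqP->|/eqP->//].
  by rewrite (fX y x) //; rewrite inE in yx.
rewrite (eq_bigr (fun x => if f x then c [set x] else 0)); last first.
  move=> x _; rewrite pick (_ : sgn k x set0 = 1) ?mul1r //.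
  by rewrite /sgn (_ : position _ _ = 0%N) //; apply: eq_card0 => y; rewrite !inE.
rewrite -big_mkcondr /= (eq_bigl f); last by move=> x; rewrite inE.
rewrite (eq_bigr (fun x => (x == v)%:R - (x == w)%:R)); last first.
  by move=> x _; rewrite !ffunE !(inj_eq set1_inj).
rewrite sumrB -!natr_sum => /eqP; rewrite subr_eq0 => /eqP E.
have cnt u : (\sum_(x | f x) (x == u) = f u)%N.
  rewrite -big_mkcondr /= sum1_card; case: (boolP (f u)) => fu.
    by rewrite (@eq_card1 _ u) // => x; rewrite unfold_in [in RHS]inE;
      case: eqVneq => [->|]; rewrite ?fu ?andbF.
  by apply: eq_card0 => x; rewrite unfold_in; case: eqVneq => [->|];
    rewrite ?(negbTE fu) ?andbF.
move: E; rewrite !cnt; case: (f v); case: (f w) => //= /eqP.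
  by rewrite oner_eq0.
by rewrite eq_sym oner_eq0.
Qed.

(** Here [m] counts vertices: the bound says that the degree [m - 1] is below the dimension of the
    link. *)
Definition cohen_macaulay X : Prop :=
  is_complex X /\ forall F, F \in X -> forall m,
    (m < card_facets (link X F))%N -> exact_at k (link X F) m.

(** There are no chains above the top degree, so top homology is the space of top cycles; [u] is a
    fundamental cycle. *)
Definition one_dimensional_top X : Prop :=
  exists u : chain k T, [/\ chain_of X (card_facets X) u, bd u = 0, u != 0 &
    forall z, chain_of X (card_facets X) z -> bd z = 0 -> exists a, z = a *: u].

Definition gorenstein_star X : Prop :=
  cohen_macaulay X /\ forall F, F \in X -> one_dimensional_top (link X F).

Lemma link_face X F G : G \in link X F ->
  F :|: G \in X /\ link (link X F) G = link X (F :|: G).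
Proof. by rewrite in_link => /andP[dGF ->]; rewrite link_link. Qed.

Lemma cohen_macaulay_link X F : F \in X -> cohen_macaulay X -> cohen_macaulay (link X F).
Proof.
move=> XF [cX eX]; split=> [|G /link_face[XFG ->]]; last exact: eX.
exact: link_is_complex.
Qed.

Lemma gorenstein_star_link X F : F \in X -> gorenstein_star X -> gorenstein_star (link X F).
Proof.
move=> XF [cX eX]; split=> [|G /link_face[XFG ->]]; last exact: eX.
exact: cohen_macaulay_link.
Qed.

Lemma cohen_macaulay_exact X m : cohen_macaulay X -> (m < card_facets X)%N -> exact_at k X m.
Proof. by move=> [[X0 _] eX]; have := eX set0 X0 m; rewrite link0. Qed.

Lemma face1 X F v : is_complex X -> F \in X -> v \in F -> [set v] \in X.
Proof. by move=> [_ Xd] XF vF; apply: Xd XF _; rewrite sub1set. Qed.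

(** By induction the links of two adjacent vertices have equal dimension, one more than the link of
    their edge. Connectedness then spreads the maximal value from a vertex of a largest face to all
    vertices. *)
Lemma cohen_macaulay_pure X F : cohen_macaulay X -> F \in X ->
  (card_facets (link X F) + #|F| = card_facets X)%N.
Proof.
have [n] := ubnP (card_facets X).
elim: n X F => // n IHn X F leXn CM XF; have cX := CM.1.
have IHv v G : [set v] \in X -> G \in link X [set v] ->
    (card_facets (link X (v |: G)) + #|G| = card_facets (link X [set v]))%N.
  move=> Xv LG; have [_ <-] := link_face LG; apply: IHn => //.
    exact: leq_trans (card_facets_link1 cX Xv) _.
  exact: cohen_macaulay_link.
have pure1 v : [set v] \in X -> (card_facets (link X [set v])).+1 = card_facets X.
  move=> Xv; have [M XM cM] := card_facets_ex cX.
  have ltv := card_facets_link1 cX Xv.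
  have [w wM] : exists w, w \in M by apply/card_gt0P; rewrite cM (leq_trans _ ltv).
  have Xw := face1 cX XM wM.
  have LMw : M :\ w \in link X [set w] by rewrite in_link1 !inE eqxx setD1K.
  have eqw : (card_facets (link X [set w])).+1 = card_facets X.
    apply/eqP; rewrite eqn_leq card_facets_link1 //= -cM (cardsD1 w) wM ltnS.
    exact: card_facets_ge.
  have [le1|gt1] := leqP (card_facets X) 1.
    by apply/eqP; rewrite eqn_leq ltv (leq_trans le1).
  apply/eqP; rewrite (connected_of_exact (cohen_macaulay_exact CM gt1)
    (f := fun x => (card_facets (link X [set x])).+1 == card_facets X) _ Xv Xw).
    by rewrite eqw.
  move=> x y nxy Xxy.
  have Xx : [set x] \in X by apply: face1 Xxy _; rewrite // !inE eqxx.
  have Xy : [set y] \in X by apply: face1 Xxy _; rewrite // !inE eqxx orbT.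
  rewrite -(IHv x [set y]) //; last by rewrite in_link1 inE nxy.
  rewrite -(IHv y [set x]) //; last by rewrite in_link1 inE eq_sym nxy setUC.
  by rewrite !cards1 setUC.
have [->|/set0Pn[v vF]] := eqVneq F set0; first by rewrite link0 cards0 addn0.
have Xv := face1 cX XF vF.
rewrite -(pure1 v Xv) -(IHv v (F :\ v)) // ?setD1K //.
  by rewrite (cardsD1 v F) vF addnS.
by rewrite in_link1 !inE eqxx setD1K.
Qed.

Lemma cohen_macaulay_facet X F : cohen_macaulay X -> maxset [in X] F ->
  #|F| = card_facets X.
Proof.
move=> CM /maxsetP[XF maxF]; rewrite -(cohen_macaulay_pure CM XF).
rewrite (_ : card_facets _ = 0%N) //; apply/eqP; rewrite -leqn0; apply/bigmax_leqP => G.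
rewrite in_link => /andP[dGF XFG]; rewrite leqn0 cards_eq0; apply/eqP.
by rewrite -(setDidPl dGF) -{1}(maxF _ XFG (subsetUl _ _)) setDUr setDv setI0.
Qed.

Lemma card_facets_link1E X v : cohen_macaulay X -> [set v] \in X ->
  (card_facets (link X [set v])).+1 = card_facets X.
Proof. by move=> CM Xv; rewrite -(cohen_macaulay_pure CM Xv) cards1 addn1. Qed.

Lemma chain_eq0 X m z : chain_of X m.+1 z -> is_complex X ->
  (forall v, [set v] \in X -> contract v z = 0) -> z = 0.
Proof.
move=> Xz cX z0; apply/ffunP => G; rewrite ffunE; apply/eqP; apply: contraT => zG.
have /andP[XG /eqP cG] := Xz G zG.
have [v vG] : exists v, v \in G by apply/card_gt0P; rewrite cG.
have /ffunP/(_ (G :\ v)) := z0 v (face1 cX XG vG).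
rewrite !ffunE !inE eqxx /= setD1K // => /eqP; rewrite mulf_eq0 (negbTE zG) orbF.
by rewrite /sgn signr_eq0.
Qed.

(** If [contract x z] vanishes and [y] is adjacent to [x], then [contract y z] is a top cycle of the
    link of [y] avoiding [x], hence 0 by induction. Connectedness spreads this to all vertices. *)
Lemma top_cycle_eq0 X v z : gorenstein_star X -> [set v] \in X ->
  chain_of X (card_facets X) z -> bd z = 0 -> contract v z = 0 -> z = 0.
Proof.
have [n] := ubnP (card_facets X).
elim: n X v z => // n IHn X v z leXn GX Xv Xz zcyc z0.
have [CM _] := GX; have cX := CM.1.
have cf1 u : [set u] \in X -> (card_facets (link X [set u])).+1 = card_facets X.
  exact: card_facets_link1E.
have Xz' : chain_of X (card_facets (link X [set v])).+1 z by rewrite cf1.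
have [gt1|] := ltnP 1 (card_facets X).
  apply: (chain_eq0 Xz' cX) => w Xw.
  have := connected_of_exact (cohen_macaulay_exact CM gt1)
    (f := fun x => contract x z == 0) _ Xv Xw.
  rewrite z0 eqxx => H; apply/eqP; rewrite -H //.
  have edge x y : x != y -> [set x; y] \in X -> contract x z == 0 -> contract y z == 0.
    move=> nxy Xxy /eqP zx.
    have Xx : [set x] \in X by apply: face1 Xxy _; rewrite // !inE eqxx.
    have Xy : [set y] \in X by apply: face1 Xxy _; rewrite // !inE eqxx orbT.
    apply/eqP; apply: (IHn (link X [set y]) x).
    - exact: leq_trans (card_facets_link1 cX Xy) _.
    - exact: gorenstein_star_link.
    - by rewrite in_link1 inE eq_sym nxy setUC.
    - by have := @chain_of_contract _ _ _ _ y _ Xz; rewrite -(cf1 y Xy).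
    - by rewrite bd_contract zcyc raddf0 oppr0.
    - by rewrite contractC zx raddf0 oppr0.
  by move=> x y nxy Xxy; apply/idP/idP; apply: edge; rewrite // 1?eq_sym // setUC.
rewrite -(cf1 v Xv) ltnS leqn0 => /eqP c0; have c1 := cf1 v Xv; rewrite c0 in c1.
rewrite c0 in Xz'; apply/eqP/contraT => nz.
have [u [Xu ucyc nu uP]] : one_dimensional_top X by rewrite -[X]link0; apply: GX.2; case: cX.
have [G zG] : exists G, z G != 0.
  apply/existsP; apply: contraNT nz; rewrite negb_exists => /forallP zz.
  by apply/eqP/ffunP => G; rewrite ffunE; apply/eqP; have := zz G; rewrite negbK.
have /andP[XG /cards1P[w ew]] := Xz' G zG; rewrite ew in zG XG.
have zv : z [set v] = 0.
  have /ffunP/(_ set0) := z0; rewrite !ffunE inE setU0 => /eqP.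
  by rewrite mulf_eq0 /sgn signr_eq0 => /eqP.
have nwv : w != v by apply: contraNneq zG => ->; rewrite zv.
pose c : chain k T := simplex k [set v] - simplex k [set w].
have [||a ca] := uP c.
- rewrite -c1 => H; rewrite !ffunE.
  case: (H =P [set v]) => [->|_]; first by rewrite Xv cards1.
  case: (H =P [set w]) => [->|_]; first by rewrite XG cards1.
  by rewrite subrr eqxx.
- by rewrite raddfB /= !bd_simplexE !bd_simplex1 subrr.
have [b zb] := uP z Xz zcyc.
have cv : c [set v] = 1.
  by rewrite !ffunE eqxx (inj_eq set1_inj) eq_sym (negbTE nwv) subr0.
have : u [set v] != 0.
  by apply/eqP => u0; move: cv; rewrite ca ffunE u0 scaler0 => /esym/eqP; rewrite oner_eq0.
move: zv; rewrite {1}zb ffunE => /eqP; rewrite mulf_eq0 => /orP[/eqP b0|->//].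
by case/eqP: nz; rewrite zb b0 scale0r.
Qed.

Lemma chain_of_ge X m z : (card_facets X < m)%N -> chain_of X m z -> z = 0.
Proof.
move=> ltm Xz; apply/ffunP => G; rewrite ffunE; apply/eqP; apply: contraT => /Xz.
by case/andP=> /card_facets_ge leG /eqP cG; rewrite cG leqNgt ltm in leG.
Qed.

(** In the top degree of [X] no nonzero cycle avoids [v]. Below it, fill the cycle in [X] and push
    the filling off [v]; the only obstruction is a top cycle of the link, which a multiple of the
    fundamental cycle of [X] removes. *)
Lemma acyclic_deletion_vertex X v : gorenstein_star X -> [set v] \in X ->
  acyclic k (deletion X [set v]).
Proof.
move=> GX Xv m z /chain_of_deletion[Xz z0] zcyc.
have [CM _] := GX; have cX := CM.1; have cf := card_facets_link1E CM Xv.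
have [ltm|] := ltnP m (card_facets X); last first.
  rewrite leq_eqVlt => /predU1P[em|gtm].
    rewrite (top_cycle_eq0 GX Xv _ zcyc z0) ?em //.
    by exists 0; rewrite ?raddf0 //; apply: chain_of0.
  rewrite (chain_of_ge gtm Xz).
  by exists 0; rewrite ?raddf0 //; apply: chain_of0.
have [c Xc cbd] := cohen_macaulay_exact CM ltm Xz zcyc.
have c1cyc : bd (contract v c) = 0 by rewrite bd_contract cbd z0 oppr0.
have CL := cohen_macaulay_link Xv CM.
have [ltm1|lem1] := ltnP m (card_facets (link X [set v])).
  have [e Xe ebd] := cohen_macaulay_exact CL ltm1 (@chain_of_contract _ _ _ _ v _ Xc) c1cyc.
  by rewrite -cbd; apply: bounds_in_deletion ebd.
have em : m = card_facets (link X [set v]) by apply/eqP; rewrite eqn_leq lem1 -ltnS cf ltm.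
have [u [Xu ucyc nu _]] : one_dimensional_top X by rewrite -[X]link0; apply: GX.2; case: cX.
have [t [Xt tcyc nt tP]] := GX.2 _ Xv.
have Lu := @chain_of_contract _ _ _ _ v _ Xu; rewrite -cf /= in Lu.
have [|a ua] := tP _ Lu; first by rewrite bd_contract ucyc raddf0 oppr0.
have [b cb] : exists b, contract v c = b *: t.
  by apply: tP => //; rewrite -em; have := @chain_of_contract _ _ _ _ v _ Xc.
have na : a != 0.
  apply: contraNneq nu => a0; apply/eqP/(top_cycle_eq0 GX Xv Xu ucyc).
  by rewrite ua a0 scale0r.
rewrite em cf in Xc *.
(* The contractions of [c] and [u] are [b *: t] and [a *: t]. Subtracting [b / a] times the cycle
   [u] keeps the boundary and clears [v], so the filling in the link is 0. *)
have [|||c' Xc' cbd'] := @bounds_in_deletion k T X (card_facets X) v (c - (b / a) *: u) 0 cX.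
- by apply: chain_ofB => //; apply: chain_ofZ.
- exact: chain_of0.
- rewrite raddf0 raddfB /= linearZ /= ua cb scalerA divfK // subrr //.
by exists c' => //; rewrite cbd' raddfB /= linearZ /= ucyc scaler0 subr0.
Qed.
End CohenMacaulay.

(** * Deleting several vertices *)

Section Deletions.
Variables (k : fieldType) (T : finType).
Implicit Types (X Y : {set {set T}}) (F G J A W : {set T}) (v w x y : T).

Lemma deletionU X J A : deletion (deletion X J) A = deletion X (J :|: A).
Proof.
by apply/setP => G; rewrite !inE -!setI_eq0 setIUr setU_eq0 andbA.
Qed.

Lemma link_deletion X F J : [disjoint F & J] ->
  link (deletion X J) F = deletion (link X F) J.
Proof.
rewrite -setI_eq0 => /eqP dFJ; apply/setP => G.
by rewrite in_link !inE in_link -!setI_eq0 setIUl dFJ set0U andbA.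
Qed.

Lemma acyclic_set0 : acyclic k (set0 : {set {set T}}).
Proof.
move=> m z z0 _; exists 0; first exact: chain_of0.
rewrite raddf0; apply/esym/ffunP => G; rewrite ffunE; apply/eqP.
by apply: contraT => /z0; rewrite inE.
Qed.

Lemma link_nonface X v : is_complex X -> [set v] \notin X -> link X [set v] = set0.
Proof.
move=> cX nX; apply/setP => G; rewrite in_link1 inE; apply/negP => /andP[_ XvG].
by case/negP: nX; apply: face1 XvG _; rewrite // setU11.
Qed.

(** The part of [X] inside [J] is a cone with apex [v]. Remove some [x != v] last: its link at that
    stage is the link of [x] in [X] with [J :\ x] deleted, and [v] is again an apex there, so
    induction covers both pieces. *)
Lemma acyclic_deletion_cone X J v : gorenstein_star k X -> v \in J -> [set v] \in X ->
    (forall G, G \in X -> G \subset J -> v |: G \in X) ->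
  acyclic k (deletion X J).
Proof.
have [n] := ubnP #|J|; elim: n X J => // n IHn X J leJ GX vJ Xv Xcone.
have cX := GX.1.1.
have [eJ|/set0Pn[x /setD1P[nxv xJ]]] := eqVneq (J :\ v) set0.
  by rewrite -(setD1K vJ) eJ setU0; apply: acyclic_deletion_vertex.
have ltJ : (#|J :\ x| < n)%N by move: leJ; rewrite (cardsD1 x J) xJ.
have vJx : v \in J :\ x by rewrite !inE eq_sym nxv vJ.
have xJx : [disjoint [set x] & J :\ x] by rewrite disjoints1 !inE eqxx.
have <- : deletion (deletion X (J :\ x)) [set x] = deletion X J.
  by rewrite deletionU setUC setD1K.
apply: acyclic_deletion; first exact: deletion_is_complex.
  by apply: IHn => // G XG sGJ; apply: Xcone => //; apply: subset_trans sGJ (subsetDl _ _).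
rewrite link_deletion //.
have [Xx|nX] := boolP ([set x] \in X); last first.
  rewrite link_nonface // (_ : deletion _ _ = set0); first exact: acyclic_set0.
  by apply/setP => G; rewrite !inE.
apply: IHn => //; first exact: gorenstein_star_link.
  by rewrite in_link1 inE nxv setUC Xcone // sub1set.
move=> G; rewrite !in_link1 => /andP[xG XxG] sGJ; rewrite !inE negb_or nxv xG /=.
rewrite setUCA; apply: Xcone => //; rewrite subUset sub1set xJ.
exact: subset_trans sGJ (subsetDl _ _).
Qed.

(** This will describe the chains left after removing the edges inside an interval; see
    [order_complex_ominus]. *)
Definition thin X J : {set {set T}} := [set G in X | (#|G :&: J| <= 1)%N].

Lemma in_thin X J G : (G \in thin X J) = (G \in X) && (#|G :&: J| <= 1)%N.
Proof. by rewrite inE. Qed.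

Lemma in_deletion X J G : (G \in deletion X J) = (G \in X) && [disjoint G & J].
Proof. by rewrite inE. Qed.

Lemma thin_is_complex X J : is_complex X -> is_complex (thin X J).
Proof.
move=> [X0 Xd]; split=> [|F G]; first by rewrite inE X0 set0I cards0.
rewrite !inE => /andP[XF leF] sGF; rewrite (Xd F) //=.
by apply: leq_trans leF; apply: subset_leq_card; apply: setSI.
Qed.

(** A thin face through [x] in [J] has no other vertex in [J], so putting [x] back glues in a cone
    over the deletion of [J] from its link. *)
Lemma acyclic_thin X J : is_complex X -> acyclic k (deletion X J) ->
    (forall x, x \in J -> [set x] \in X -> acyclic k (deletion (link X [set x]) J)) ->
  acyclic k (thin X J).
Proof.
(* A filtration from the deletion, [Y set0], to the thin complex, [Y J]. *)
move=> cX aD aL; pose Y A := [set G in thin X J | G :&: J \subset A].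
have cY A : is_complex (Y A).
  have [X0 Xd] := thin_is_complex J cX; split=> [|F G]; first by rewrite inE X0 set0I sub0set.
  rewrite !(in_set (fun G => (G \in thin X J) && _)) => /andP[XF leF] sGF.
  by rewrite (Xd F) //=; apply: subset_trans leF; apply: setSI.
suff : forall A, A \subset J -> acyclic k (Y A).
  move=> /(_ J (subxx _)); congr acyclic; apply/setP => G.
  by rewrite !inE subsetIr andbT.
move=> A; have [n] := ubnP #|A|; elim: n A => // n IHn A leA sAJ.
have [->|/set0Pn[x xA]] := eqVneq A set0.
  move: aD; congr acyclic; apply/setP => G.
  rewrite !inE subset0 -setI_eq0; case: eqVneq => [->|]; last by rewrite !andbF.
  by rewrite cards0 !andbT.
have xJ := subsetP sAJ x xA.
apply: (@acyclic_of_deletion _ _ _ x) => //.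
  rewrite (_ : deletion _ _ = Y (A :\ x)).
    apply: IHn; first by move: leA; rewrite (cardsD1 x A) xA.
    exact: subset_trans (subsetDl _ _) sAJ.
  apply/setP => G; rewrite in_deletion1 !inE -!andbA; congr [&& _, _ & _].
  by rewrite subsetD1 inE xJ andbT.
have [Xx|nX] := boolP ([set x] \in X); last first.
  rewrite link_nonface //; first exact: acyclic_set0.
  by rewrite !inE (negbTE nX).
have := aL x xJ Xx; congr acyclic; apply/setP => G.
rewrite !inE !in_link1 !inE -setI_eq0; have [//|xG /=] := boolP (x \in G).
rewrite -andbA; congr (_ && _).
have -> : (x |: G) :&: J = x |: (G :&: J) by rewrite setIUl (setIidPl _) // sub1set.
rewrite cardsU1 inE (negbTE xG) /= add1n ltnS leqn0 cards_eq0 subUset sub1set xA /=.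
by case: eqVneq => // ->; rewrite sub0set.
Qed.

(** * Complexes of chains, contracted by meets *)

Variable le : rel T.

(** The relation is a parameter so that both an order and its dual can be used. *)
Definition clique W : {set {set T}} :=
  [set C : {set T} | (C \subset W) && [forall x in C, forall y in C, le x y || le y x]].

Lemma cliqueP W (C : {set T}) : reflect
  (C \subset W /\ forall x y, x \in C -> y \in C -> le x y || le y x) (C \in clique W).
Proof.
rewrite inE; apply: (iffP andP) => -[sCW cC]; split=> //.
  by move=> x y xC yC; move/forall_inP: cC => /(_ x xC)/forall_inP/(_ y yC).
by apply/forall_inP => x xC; apply/forall_inP => y yC; apply: cC.
Qed.

Lemma clique_is_complex W : is_complex (clique W).
Proof.
split=> [|F G]; first by apply/cliqueP; split=> [|x y]; rewrite ?sub0set ?inE.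
move=> /cliqueP[sFW cF] sGF; apply/cliqueP; split; first exact: subset_trans sFW.
by move=> x y /(subsetP sGF) xF /(subsetP sGF); apply: cF.
Qed.

Hypothesis le_refl : reflexive le.
Hypothesis le_anti : antisymmetric le.
Hypothesis le_trans : transitive le.

Lemma clique_setU1 W (C : {set T}) p : p \in W -> C \in clique W ->
  (forall x, x \in C -> le x p || le p x) -> p |: C \in clique W.
Proof.
move=> pW /cliqueP[sCW cC] cp; apply/cliqueP; split; first by rewrite subUset sub1set pW.
move=> x y /setU1P[->|xC] /setU1P[->|yC]; rewrite ?le_refl ?cp //; last exact: cC.
by rewrite orbC cp.
Qed.

(* Removing the elements z that are not below m, minimal ones first, each from
   a complex in which its link is a cone over the meet p of z and m. *)
Lemma acyclic_clique_meets W m : m \in W ->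
    (forall z, z \in W -> exists2 p, p \in W & forall t, t \in W ->
       le t p = le t z && le t m) ->
  acyclic k (clique W).
Proof.
have [n] := ubnP #|[set z in W | ~~ le z m]|; elim: n W => // n IHn W leW mW meets.
have [nobody|/set0Pn[z1]] := eqVneq [set z in W | ~~ le z m] set0.
  apply: (@acyclic_cone _ _ _ m) => G XG; apply: clique_setU1 => // x xG.
  have xW : x \in W by case/cliqueP: XG => /subsetP sGW _; apply: sGW.
  by move/setP: nobody => /(_ x); rewrite !inE xW /= => /negbFE ->.
case/setIdP=> z1W z1m.
(* Having the fewest elements below it makes [z] minimal among those not below [m]. *)
have [z /andP[zW zm] zmin] := @arg_minnP _ z1 (fun z => (z \in W) && ~~ le z m)
  (fun z => #|[set t in W | le t z]|) (introT andP (conj z1W z1m)).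
have below t : t \in W -> le t z -> t != z -> le t m.
  move=> tW tz ntz; apply: contraT => ntm.
  have := zmin t; rewrite tW ntm => /(_ isT); rewrite leqNgt => /negP[].
  apply: proper_card; apply/properP; split.
    by apply/subsetP => s; rewrite !inE => /andP[-> /le_trans]; apply.
  exists z; rewrite !inE zW ?le_refl //=; apply: contra ntz => zt.
  by apply/eqP/le_anti; rewrite tz.
have [p pW pP] := meets z zW.
have /andP[pz pm] : le p z && le p m by rewrite -pP // le_refl.
apply: (@acyclic_of_deletion _ _ _ z); first exact: clique_is_complex.
  rewrite (_ : deletion _ _ = clique (W :\ z)); last first.
    by apply/setP => G; rewrite in_deletion1 !inE subsetD1 -!andbA;
      congr (_ && _); rewrite andbC.
  apply: IHn.
  - rewrite -ltnS; apply: leq_trans leW; rewrite ltnS.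
    apply: proper_card; apply/properP; split.
      by apply/subsetP => t; rewrite !inE -andbA => /and3P[_ -> ->].
    by exists z; rewrite !inE ?eqxx ?zW.
  - by rewrite !inE mW andbT; apply: contraNneq zm => <-.
  (* The meets with [m] survive the removal of [z]: they lie below [m], and [z] does not. *)
  - move=> t /setD1P[_ tW]; have [q qW qP] := meets t tW.
    have /andP[_ qm] : le q t && le q m by rewrite -qP // le_refl.
    exists q; first by rewrite !inE qW andbT; apply: contraNneq zm => <-.
    by move=> s /setD1P[_ sW]; apply: qP.
(* In the link of [z], elements below [z] are below [m], hence below [p]; elements above [z] are
   above [p]. *)
apply: (@acyclic_cone _ _ _ p) => G; rewrite !in_link1 => /andP[zG XzG].
have npz : p != z by apply: contraNneq zm => <-.
rewrite in_setU1 negb_or eq_sym npz zG /= setUCA; apply: clique_setU1 => //.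
have [/subsetP sW cG] := cliqueP _ _ XzG.
move=> x /setU1P[->|xG]; first by rewrite pz orbT.
have xzG : x \in z |: G by rewrite !inE xG orbT.
have nxz : x != z by apply: contraNneq zG => <-.
have /orP[xz|zx] := cG x z xzG (setU11 _ _).
  by rewrite pP ?sW // xz below // sW.
by rewrite (le_trans pz zx) orbT.
Qed.
End Deletions.

(** * Comparison with the homology spaces *)

Section HomologyTranslation.
Variables (k : fieldType) (T : finType).
Implicit Types (X Y : {set {set T}}) (F G : {set T}) (c z : chain k T).

Lemma chain_decomp c : c = \sum_F c F *: simplex k F.
Proof.
apply/ffunP => G; rewrite sum_ffunE (bigD1 G) //= !ffunE eqxx [_ *: _]mulr1.
rewrite big1 ?addr0 // => F nFG.
by rewrite !ffunE eq_sym (negbTE nFG) scaler0.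
Qed.

Lemma mem_chains X (i : int) m c : i + 1 = m%:Z ->
  reflect (chain_of X m c) (c \in chains k X i).
Proof.
move=> im; have dimE G : (face_dim G == i) = (#|G| == m).
  by rewrite /face_dim subr_eq im eqz_nat.
apply: (iffP idP) => [/coord_span ->|Xc].
  apply: (big_ind (chain_of X m)) => [|c1 c2|j _]; first exact: chain_of0.
    exact: chain_ofD.
  apply: chain_ofZ.
  have := @mem_nth _ 0 [seq simplex k F | F in [set G in X | face_dim G == i]] j.
  rewrite size_image ltn_ord => /(_ isT) /imageP[F /setIdP[XF dF] -> G]; rewrite dimE in dF.
  by rewrite ffunE; have [->|_] := eqVneq G F; rewrite ?eqxx // XF.
rewrite (chain_decomp c); apply: memv_suml => F _.
have [->|/Xc /andP[XF dF]] := eqVneq (c F) 0; first by rewrite scale0r mem0v.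
by apply/memvZ/memv_span/image_f; rewrite inE XF dimE.
Qed.

Lemma mem_cycles X (i : int) m z : i + 1 = m%:Z ->
  reflect (chain_of X m z /\ bd z = 0) (z \in cycles k X i).
Proof.
move=> im; rewrite memv_cap memv_ker lfunE /=.
by apply: (iffP andP) => -[/(mem_chains _ _ im) ? /eqP].
Qed.

Lemma homology_eq0 X (i : int) m : i + 1 = m%:Z ->
  (homology k X i = 0%VS) <-> exact_at k X m.
Proof.
move=> im; have im1 : i + 1 + 1 = m.+1%:Z by rewrite im -addn1 PoszD.
split=> [/eqP | ex].
  rewrite diffv_eq0 => /subvP sub z Xz zcyc.
  have /sub/memv_imgP[e /(mem_chains _ _ im1) Xe ->] : z \in cycles k X i.
    exact/(mem_cycles _ _ im).
  by exists e; rewrite ?lfunE.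
apply/eqP; rewrite diffv_eq0; apply/subvP => z /(mem_cycles _ _ im)[Xz zcyc].
have [e Xe <-] := ex z Xz zcyc; apply/memv_imgP; exists e; last by rewrite lfunE.
exact/(mem_chains _ _ im1).
Qed.

Lemma chains_lt0 X (i : int) : i + 1 < 0 -> chains k X i = 0%VS.
Proof.
move=> i0; rewrite /chains (_ : [set G in X | face_dim G == i] = set0).
  by rewrite /image_mem enum_set0 span_nil.
apply/setP => G; rewrite !inE /face_dim subr_eq; case: eqP => [e|]; last by rewrite andbF.
by rewrite -e in i0.
Qed.

(** Degrees [i] below -1 carry no chains; the others correspond to [m = i + 1]. *)
Lemma CM_complexP X : is_complex X -> CM_complex k X <-> cohen_macaulay k X.
Proof.
move=> cX; split=> [CM|[_ CM] F XF i].
  split=> // F XF m ltm; have e : (m%:Z - 1) + 1 = m%:Z by rewrite subrK.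
  by apply/(homology_eq0 _ e)/CM; rewrite // /complex_dim ltrD2r ltz_nat.
rewrite /complex_dim ltrBDr => lti; have [i0|i0] := ltP (i + 1) 0.
  by apply/eqP; rewrite diffv_eq0 /cycles chains_lt0 // cap0v sub0v.
have im : i + 1 = `|(i + 1)%R|%N%:Z by rewrite gez0_abs.
by apply/(homology_eq0 _ im)/CM => //; move: lti; rewrite im ltz_nat.
Qed.

(** Top homology equals the space of top cycles, since there is nothing above to bound; the preimage
    of 1 under the isomorphism with the field is a fundamental cycle. *)
Lemma Gorenstein_star_complexW X : is_complex X ->
  Gorenstein_star_complex k X -> gorenstein_star k X.
Proof.
move=> cX [/(CM_complexP cX) CM G]; split=> // F XF.
have [f [g fK gK]] := G F XF; set Y := link X F in f g fK gK *.
have im : complex_dim Y + 1 = (card_facets Y)%:Z by rewrite subrK.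
have im1 : complex_dim Y + 1 + 1 = (card_facets Y).+1%:Z by rewrite im -addn1 PoszD.
have HE : homology k Y (complex_dim Y) = cycles k Y (complex_dim Y).
  rewrite /homology (_ : boundaries k Y _ = 0%VS).
    by have := addv_diff (cycles k Y (complex_dim Y)) 0; rewrite !addv0.
  apply/eqP; rewrite -subv0; apply/subvP => z /memv_imgP[c /(mem_chains _ _ im1) Yc ->].
  by rewrite (chain_of_ge _ Yc) // linear0 mem0v.
have memH (u : subvs_of (homology k Y (complex_dim Y))) :
    chain_of Y (card_facets Y) (vsval u) /\ bd (vsval u) = 0.
  by apply/(mem_cycles _ _ im); rewrite -HE subvsP.
exists (vsval (g 1)); have [Yu ucyc] := memH (g 1); split=> //.
  apply/eqP => u0; have : f (g 1) = 0.
    by rewrite (_ : g 1 = 0) ?linear0 //; apply/val_inj; rewrite /= u0.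
  by rewrite gK => /eqP; rewrite oner_eq0.
move=> z Yz zcyc; have Hz : z \in homology k Y (complex_dim Y).
  by rewrite HE; apply/(mem_cycles _ _ im).
set y := vsproj (homology k Y (complex_dim Y)) z.
have ey : y = f y *: g 1 by apply: (can_inj fK); rewrite linearZ /= gK [_ *: _]mulr1.
exists (f y); rewrite -[LHS](vsprojK Hz) -/y {1}ey.
by rewrite linearZ.
Qed.

Lemma gorenstein_star_not_acyclic X : gorenstein_star k X -> ~ acyclic k X.
Proof.
move=> GX aX; have cX := GX.1.1.
have [u [Xu ucyc nu _]] : one_dimensional_top k X by rewrite -[X]link0; apply: GX.2; case: cX.
have [e Xe eu] := aX _ u Xu ucyc; case/eqP: nu; rewrite -eu.
by rewrite (chain_of_ge _ Xe) // raddf0.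
Qed.
End HomologyTranslation.

(** * Intervals of a Gorenstein* lattice *)

Section OrderComplexes.
Local Open Scope order_scope.
Variables (d : Order.disp_t) (P : finPOrderType d).
Implicit Types (x y z : P) (C F I : {set P}).

Lemma order_complexE : order_complex P = clique <=%O setT.
Proof. by apply/setP => C; rewrite !inE subsetT. Qed.

Lemma order_complexP C : reflect
  (forall x y, x \in C -> y \in C -> x >=< y) (C \in order_complex P).
Proof.
by rewrite order_complexE; apply: (iffP (cliqueP _ _ _)) => [[_ cC]|cC] //.
Qed.

Lemma order_complexU1 C x : C \in order_complex P ->
  (forall y, y \in C -> y >=< x) -> x |: C \in order_complex P.
Proof.
by rewrite order_complexE => CC cx; apply: clique_setU1 CC cx; rewrite ?inE.
Qed.

Lemma exists_cover_above x y : x < y -> exists2 z, covers x z & z <= y.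
Proof.
move=> ltxy; have := ltW ltxy; rewrite covers_connect => /connectP[[|z p] /=].
  by move=> _ exy; rewrite exy ltxx in ltxy.
case/andP=> cz pz ey; exists z => //.
by rewrite covers_connect; apply/connectP; exists p.
Qed.

Lemma exists_cover_below x y : x < y -> exists2 z, covers z y & x <= z.
Proof.
move=> ltxy; have := ltW ltxy; rewrite covers_connect => /connectP[p].
case/lastP: p => [|p z].
  by move=> _ exy; rewrite exy ltxx in ltxy.
rewrite last_rcons rcons_path => /andP[pz cz] ez; rewrite ez.
exists (last x p) => //.
by rewrite covers_connect; apply/connectP; exists p.
Qed.
End OrderComplexes.

Section LatticeIntervals.
Local Open Scope order_scope.
Variables (k : fieldType) (d : Order.disp_t) (L : finTBLatticeType d).
Notation P := (proper_part L).
Notation X := (order_complex P).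
Implicit Types (x y z a b m : L) (F G C : {set P}) (u v w t : P).

(** The ends are taken in [L], so that they may be its bottom or top. *)
Definition open_interval x y : {set P} := [set z : P | x < val z < y].

Lemma val_gt0 w : \bot < val w.
Proof. by rewrite lt0x; case/andP: (valP w). Qed.

Lemma val_lt1 w : val w < \top.
Proof. by rewrite ltx1; case/andP: (valP w). Qed.

Lemma proper_partP x : \bot < x -> x < \top -> exists w, val w = x.
Proof.
rewrite lt0x ltx1 => x0 x1.
by exists (exist _ x (introT andP (conj x0 x1)) : P).
Qed.

Lemma comparable_val u v : (u >=< v) = (val u >=< val v).
Proof. by []. Qed.

(* The complementary face is a maximal chain among the elements outside of the
   open interval that are comparable with all of it. *)
Lemma open_interval_link x y : x < y ->
  exists2 F, F \in X & link X F = clique <=%O (open_interval x y).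
Proof.
move=> ltxy; pose Z : {set P} := [set z : P | (val z <= x) || (y <= val z)].
have [|F /maxsetP[/andP[XF /subsetP FZ] maxF] _] :=
    @maxset_exists _ (fun C => (C \in X) && (C \subset Z)) set0.
  by rewrite sub0set andbT; case: (order_complex_is_complex P).
(* By maximality; in particular [F] contains [x] and [y] whenever they are proper. *)
have inF w : w \in Z -> (forall v, v \in F -> v >=< w) -> w \in F.
  move=> wZ wF; rewrite -(maxF (w |: F)) ?setU11 ?subsetUr // order_complexU1 //=.
  by rewrite subUset sub1set wZ; apply/subsetP.
have xF w : val w = x -> w \in F.
  move=> ex; apply: inF => [|v /FZ]; rewrite !inE ?ex ?lexx //.
  rewrite comparable_val ex => /orP[vx|yv]; first exact: le_comparable.
  exact/ge_comparable/ltW/(lt_le_trans ltxy).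
have yF w : val w = y -> w \in F.
  move=> ey; apply: inF => [|v /FZ]; rewrite !inE ?ey ?lexx ?orbT //.
  rewrite comparable_val ey => /orP[vx|yv]; last exact: ge_comparable.
  exact/le_comparable/ltW/(le_lt_trans vx).
exists F => //; apply/setP => G; rewrite in_link; apply/andP/cliqueP.
  case=> /pred0P dis /order_complexP cFG; split; last first.
    by move=> v w vG wG; apply: cFG; rewrite inE ?vG ?wG orbT.
  apply/subsetP => g gG; have gF : g \notin F.
    by apply/negP => gF; have := dis g; rewrite /= gG gF.
  have cgF v : v \in F -> v >=< g by move=> vF; apply: cFG; rewrite inE ?vF ?gG ?orbT.
  have : g \notin Z by apply: contra gF => gZ; apply: inF.
  rewrite !inE negb_or => /andP[ngx nyg]; apply/andP; split.
    have [->|x0] := eqVneq x \bot; first exact: val_gt0.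
    have [||w ew] := @proper_partP x; rewrite ?lt0x //; first exact: lt_le_trans ltxy (lex1 _).
    have := cgF w (xF w ew); rewrite comparable_val ew => /comparable_ltgtP[//|gx|eg].
      by rewrite (ltW gx) in ngx.
    by rewrite -eg lexx in ngx.
  have [->|y1] := eqVneq y \top; first exact: val_lt1.
  have [||w ew] := @proper_partP y; rewrite ?ltx1 //; first exact: le_lt_trans (le0x _) ltxy.
  have := cgF w (yF w ew); rewrite comparable_val ew => /comparable_ltgtP[yg|//|eg].
    by rewrite (ltW yg) in nyg.
  by rewrite -eg lexx in nyg.
case=> /subsetP sG cG; split.
  apply/pred0P => g /=; apply/negP => /andP[/sG]; rewrite inE => /andP[xg gy].
  by move/FZ; rewrite inE (lt_geF xg) (lt_geF gy).
have cFG f g : f \in F -> g \in G -> f >=< g.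
  move=> /FZ; rewrite inE => fZ /sG; rewrite inE => /andP[xg gy].
  rewrite comparable_val; case/orP: fZ => [fx|yf].
    exact/le_comparable/ltW/(le_lt_trans fx).
  exact/ge_comparable/ltW/(lt_le_trans gy).
apply/order_complexP => u v /setUP[uF|uG] /setUP[vF|vG].
- by move/order_complexP: XF; apply.
- exact: cFG.
- by rewrite comparable_sym; apply: cFG.
- exact: cG.
Qed.

Hypothesis GX : gorenstein_star k X.

Lemma open_interval_not_acyclic x y : x < y ->
  ~ acyclic k (clique <=%O (open_interval x y)).
Proof.
move=> /open_interval_link[F XF <-].
exact/gorenstein_star_not_acyclic/gorenstein_star_link.
Qed.

(* Otherwise every element of the open interval ]x, y[ meets b strictly above
   x, and contracting along z >= z /\ b <= y /\ b makes the interval acyclic. *)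
Lemma exists_cover_notin_below x y b : x < y -> x <= b -> ~~ (y <= b) ->
  exists z, [/\ covers x z, z <= y & ~~ (z <= b)].
Proof.
move=> ltxy xb nyb.
have [/existsP[z /and3P[]]|none] :=
  boolP [exists z, [&& covers x z, z <= y & ~~ (z <= b)]]; first by exists z.
case: (open_interval_not_acyclic ltxy).
have coverb z : covers x z -> z <= y -> z <= b.
  move=> cz zy; apply: contraNT none => nzb; apply/existsP; exists z.
  by rewrite cz zy.
have meetb z : x < z -> z <= y -> x < z `&` b.
  move=> xz zy; have [c cc cz] := exists_cover_above xz.
  have cb := coverb c cc (le_trans cz zy).
  by case/andP: cc => xc _; apply: lt_le_trans xc _; rewrite lexI cz.
have my : y `&` b < y by rewrite lt_leAnge leIl lexI lexx (negbTE nyb).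
have xm := meetb y ltxy (lexx _).
have prop z : x < z -> z < y -> exists w, val w = z.
  by move=> xz zy; apply: proper_partP; [apply: le_lt_trans xz|apply: lt_le_trans zy _].
have [m em] := prop _ xm my.
apply: (@acyclic_clique_meets k P <=%O lexx le_anti le_trans _ m).
  by rewrite inE em xm my.
move=> z; rewrite inE => /andP[xz zy].
have xp := meetb _ xz (ltW zy).
have py : val z `&` b < y by apply: le_lt_trans (leIl _ _) zy.
have [p ep] := prop _ xp py; exists p; first by rewrite inE ep xp py.
move=> t; rewrite inE => /andP[xt ty].
by rewrite !leEsub ep em !lexI (ltW ty).
Qed.

(** Dual to the previous lemma: otherwise joins with [a] stay strictly below [y] and contract the
    interval in the reverse order. *)
Lemma exists_cover_notin_above x y a : x < y -> a <= y -> ~~ (a <= x) ->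
  exists z, [/\ covers z y, x <= z & ~~ (a <= z)].
Proof.
move=> ltxy ay nax.
have [/existsP[z /and3P[]]|none] :=
  boolP [exists z, [&& covers z y, x <= z & ~~ (a <= z)]]; first by exists z.
case: (open_interval_not_acyclic ltxy).
have covera z : covers z y -> x <= z -> a <= z.
  move=> cz zy; apply: contraNT none => nza; apply/existsP; exists z.
  by rewrite cz zy.
have joina z : x <= z -> z < y -> z `|` a < y.
  move=> xz zy; have [c cc cz] := exists_cover_below zy.
  have ac := covera c cc (le_trans xz cz).
  by case/andP: cc => cy _; apply: le_lt_trans cy; rewrite leUx cz.
have xm : x < x `|` a by rewrite lt_leAnge leUl leUx lexx (negbTE nax).
have my := joina x (lexx _) ltxy.
have prop z : x < z -> z < y -> exists w, val w = z.
  by move=> xz zy; apply: proper_partP; [apply: le_lt_trans xz|apply: lt_le_trans zy _].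
have [m em] := prop _ xm my.
have -> : clique <=%O (open_interval x y) = clique >=%O (open_interval x y).
  by apply/setP => C; apply/cliqueP/cliqueP => -[sC cC]; split=> // u v uC vC;
    rewrite orbC; apply: cC.
apply: (@acyclic_clique_meets k P >=%O lexx ge_anti ge_trans _ m).
  by rewrite inE em xm my.
move=> z; rewrite inE => /andP[xz zy].
have py := joina _ (ltW xz) zy.
have xp : x < val z `|` a by apply: lt_le_trans xz (leUl _ _).
have [p ep] := prop _ xp py; exists p; first by rewrite inE ep xp py.
move=> t; rewrite inE => /andP[xt ty].
by rewrite /= !leEsub ep em !leUx (ltW xt).
Qed.
End LatticeIntervals.

(** * Removing the edges of an interval *)

Section EdgeDeletion.
Local Open Scope order_scope.
Variables (k : fieldType) (d : Order.disp_t) (L : finTBLatticeType d).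
Notation P := (proper_part L).
Notation X := (order_complex P).
Hypothesis GX : gorenstein_star k X.
Variables a b : P.
Notation I := (closed_interval a b).
Implicit Types (F G C : {set P}) (u v w x y z t : P).

Lemma covers_val x z : covers (val x) (val z) -> covers x z.
Proof.
case/andP=> xz /forallP no; apply/andP; split; first exact: xz.
by apply/forallP => t; apply: no.
Qed.

(** As [a <= x < y], the element [y] is outside [I] only because it is not below [b]; a cover of [x]
    not below [b] is then outside [I] too. *)
Lemma ominus_step_up x y : x \in I -> y \notin I -> x < y ->
  exists z, [/\ covers x z, z <= y & z \notin I].
Proof.
rewrite !inE => /andP[ax xb] yI xy; have ay := le_trans ax (ltW xy).
rewrite ay /= in yI.
have [z [cz zy zb]] := exists_cover_notin_below GX xy xb yI.
have [||z' ez] := @proper_partP d L z.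
- by apply: lt_trans (val_gt0 x) _; case/andP: cz.
- exact: le_lt_trans zy (val_lt1 y).
exists z'; rewrite -ez in cz zy zb; split=> //; first exact: covers_val.
by rewrite !inE negb_and zb orbT.
Qed.

Lemma ominus_step_down x y : x \notin I -> y \in I -> x < y ->
  exists z, [/\ covers z y, x <= z & z \notin I].
Proof.
rewrite !inE => xI /andP[ay yb] xy; have xb := le_trans (ltW xy) yb.
rewrite xb andbT in xI.
have [z [cz xz az]] := exists_cover_notin_above GX xy ay xI.
have [||z' ez] := @proper_partP d L z.
- exact: lt_le_trans (val_gt0 x) xz.
- by apply: lt_trans (val_lt1 y); case/andP: cz.
exists z'; rewrite -ez in cz xz az; split=> //; first exact: covers_val.
by rewrite !inE negb_and az.
Qed.

(** Induction on the size of [x, y]. An end in [I] is joined by a surviving cover to an element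
    outside [I]; if both ends are outside, any intermediate element splits the interval. *)
Lemma ominus_le_lt x y : x < y -> ~~ ((x \in I) && (y \in I)) -> ominus_le I x y.
Proof.
have [n] := ubnP #|[set z | x <= z <= y]|; elim: n x y => // n IHn x y ltn ltxy nI.
have smaller u v : x <= u -> u < v -> v <= y -> (x < u) || (v < y) ->
    ~~ ((u \in I) && (v \in I)) -> ominus_le I u v.
  move=> xu uv vy xuvy; apply: IHn uv; rewrite -ltnS; apply: leq_trans ltn; rewrite ltnS.
  apply: proper_card; apply/properP; split.
    apply/subsetP => t; rewrite !inE => /andP[ut tv].
    by rewrite (le_trans xu ut) (le_trans tv vy).
  case/orP: xuvy => [xu'|vy']; [exists x|exists y]; rewrite !inE ?lexx ?(ltW ltxy) //.
    by rewrite lt_geF.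
  by rewrite (lt_geF vy') andbF.
have step u v : covers u v -> ~~ ((u \in I) && (v \in I)) -> ominus_le I u v.
  by move=> cuv nuv; apply: connect1; rewrite /ominus_covers cuv.
have [xI|xI] := boolP (x \in I).
  rewrite xI /= in nI; have [z [cz zy zI]] := ominus_step_up xI nI ltxy.
  have xz : ominus_le I x z by apply: step; rewrite // (negbTE zI) andbF.
  move: zy; rewrite le_eqVlt => /predU1P[<-//|zy].
  apply: connect_trans xz _; apply: smaller; rewrite ?(negbTE zI) //.
    by case/andP: cz => /ltW.
  by case/andP: cz => ->.
have [yI|yI] := boolP (y \in I).
  have [z [cz xz zI]] := ominus_step_down xI yI ltxy.
  have zy : ominus_le I z y by apply: step; rewrite // (negbTE zI).
  move: xz; rewrite le_eqVlt => /predU1P[->//|xz].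
  apply: connect_trans zy; apply: smaller; rewrite ?(negbTE zI) ?andbF //.
    by case/andP: cz => /ltW.
  by case/andP: cz => ->; rewrite orbT.
have [cxy|] := boolP (covers x y); first exact: step.
rewrite /covers ltxy /= negb_forall => /existsP[z]; rewrite negbK => /andP[xz zy].
apply: (@connect_trans _ _ z); apply: smaller; rewrite ?xz ?zy ?orbT ?(ltW xz) ?(ltW zy) //.
  by rewrite (negbTE xI).
by rewrite (negbTE yI) andbF.
Qed.

(** For the converse, [I] is convex: a nontrivial path between two of its elements would start with
    a removed edge. *)
Lemma ominus_leE x y :
  ominus_le I x y = (x == y) || (x < y) && ~~ ((x \in I) && (y \in I)).
Proof.
apply/idP/idP => [le'xy|/predU1P[->|/andP[]]]; last 1 first.
- exact: ominus_le_lt.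
- have [//|nxy /=] := eqVneq x y; have lexy := ominus_le_le le'xy.
  rewrite lt_neqAle nxy lexy /=; apply/negP => /andP[xI yI].
  case/connectP: le'xy => [[|z p] /=]; first by move=> _ exy; rewrite exy eqxx in nxy.
  case/andP=> /andP[/andP[xz _] nxzI] pz ey; case/negP: nxzI; rewrite xI.
  have zy : z <= y by apply: (@ominus_le_le _ _ I); apply/connectP; exists p.
  move: xI yI; rewrite !inE => /andP[ax _] /andP[_ yb].
  by rewrite (le_trans ax (ltW xz)) (le_trans zy yb).
- exact: connect0.
Qed.

Lemma order_complex_ominus : order_complex (ominus I) = thin X I.
Proof.
apply/setP => C; rewrite [RHS]inE; apply/order_complexP/andP => [cC|[/order_complexP cC]].
  have cmp x y : x \in C -> y \in C ->
      (x >=< y) && ((x == y) || ~~ ((x \in I) && (y \in I))).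
    move=> xC yC; have := cC x y xC yC.
    rewrite /Order.comparable => /orP[]; rewrite [_ <= _]ominus_leE.
      by case/predU1P=> [->|/andP[/ltW -> ->]]; rewrite ?lexx ?eqxx ?orbT.
    case/predU1P=> [->|/andP[/ltW ->]]; first by rewrite lexx eqxx.
    by rewrite andbC => ->; rewrite !orbT.
  split; first by apply/order_complexP => x y xC /(cmp x y xC)/andP[].
  apply/card_le1_eqP => x y /setIP[xC xI] /setIP[yC yI].
  by have := cmp y x yC xC; rewrite xI yI orbF => /andP[_ /eqP].
move=> /card_le1_eqP le1 x y xC yC.
change (ominus_le I x y || ominus_le I y x); rewrite !ominus_leE.
have [//|nxy] := eqVneq (x : P) y.
have -> : (x \in I) && (y \in I) = false.
  apply/negP => /andP[xI yI]; case/eqP: nxy; apply: le1; exact/setIP.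
have -> : (y \in I) && (x \in I) = false.
  apply/negP => /andP[yI xI]; case/eqP: nxy; apply: le1; exact/setIP.
by have := cC x y xC yC; rewrite !andbT => /comparable_ltgtP[||exy] //; case/eqP: nxy.
Qed.

(* The elements of I comparable with all of F have a least and a greatest
   element, namely their meet and their join in L. *)
Lemma interval_bounds F x : x \in I -> (forall f, f \in F -> f >=< x) ->
  exists m M : P, [/\ m \in I, M \in I, forall f, f \in F -> f >=< m,
    forall f, f \in F -> f >=< M &
    forall y, y \in I -> (forall f, f \in F -> f >=< y) -> m <= y <= M].
Proof.
move=> xI xF; pose S : {set P} := [set y in I | [forall f in F, f >=< y]].
have SP y : reflect (y \in I /\ forall f, f \in F -> f >=< y) (y \in S).
  rewrite /S; apply: (iffP setIdP) => -[-> cF]; split=> //.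
    by move=> f fF; move/forall_inP: cF => /(_ f fF).
  by apply/forall_inP.
have xS : x \in S by apply/SP.
have [ax xb] : val a <= val x /\ val x <= val b by move: xI; rewrite inE => /andP.
pose m := \meet_(y in S) val y; pose M := \join_(y in S) val y.
have mle y : y \in S -> m <= val y by move=> yS; apply: meets_inf.
have leM y : y \in S -> val y <= M by move=> yS; apply: joins_sup.
have am : val a <= m.
  by apply/meetsP => y /SP[]; rewrite inE => /andP[].
have Mb : M <= val b.
  by apply/joinsP => y /SP[]; rewrite inE => /andP[].
have [||m' em] := @proper_partP d L m.
- exact: lt_le_trans (val_gt0 a) am.
- exact: le_lt_trans (mle x xS) (val_lt1 x).
have [||M' eM] := @proper_partP d L M.
- exact: lt_le_trans (val_gt0 x) (leM x xS).
- exact: le_lt_trans Mb (val_lt1 b).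
exists m', M'; split.
- by rewrite inE !leEsub em am /=; apply: le_trans (mle x xS) xb.
- by rewrite inE !leEsub eM Mb andbT /=; apply: le_trans ax (leM x xS).
- move=> f fF; rewrite comparable_val em.
  (* Either [f] is below all of [S], hence below [m], or it is above some [y] in [S], hence above
     [m]. *)
  have [/forall_inP all|/forall_inPn[y yS nfy]] := boolP [forall y in S, f <= y].
    by apply/le_comparable/meetsP => y /all.
  have [_ /(_ f fF)/orP[fy|yf]] := SP y yS; first by rewrite fy in nfy.
  by apply/ge_comparable; apply: le_trans (mle y yS) (yf : val y <= val f).
- move=> f fF; rewrite comparable_val eM.
  have [/forall_inP all|/forall_inPn[y yS nfy]] := boolP [forall y in S, y <= f].
    by apply/ge_comparable/joinsP => y /all.
  have [_ /(_ f fF)/orP[fy|yf]] := SP y yS; last by rewrite yf in nfy.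
  by apply/le_comparable; apply: le_trans (fy : val f <= val y) (leM y yS).
- by move=> y yI yF; rewrite !leEsub em eM mle ?leM //; apply/SP.
Qed.

(** * Links of chains, the Cohen-Macaulay property and the rank *)

Lemma link_vertexP F x : F \in X ->
  reflect (x \notin F /\ forall f, f \in F -> f >=< x) ([set x] \in link X F).
Proof.
move=> XF; rewrite in_link disjoints1; apply: (iffP andP) => -[-> cF]; split=> //.
  by move=> f fF; move/order_complexP: cF; apply; rewrite !inE ?fF ?eqxx ?orbT.
by rewrite setUC; apply: order_complexU1.
Qed.

(** The apex is the least or the greatest element of [interval_bounds]. If both were in [F] they
    would coincide, [F] having at most one element in [I], and [x] between them would be in [F]. *)
Lemma link_apex F x : F \in thin X I -> x \in I -> [set x] \in link X F ->
  exists v, [/\ v \in I, [set v] \in link X F &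
    forall y, y \in I -> [set y] \in link X F -> v >=< y].
Proof.
rewrite inE => /andP[XF /card_le1_eqP le1] xI /(link_vertexP _ XF)[xF cxF].
have [m [M [mI MI mF MF mM]]] := interval_bounds xI cxF.
have [mF'|nmF] := boolP (m \in F); last first.
  exists m; split=> //; first exact/link_vertexP.
  by move=> y yI /(link_vertexP _ XF)[_ /(mM y yI)/andP[/le_comparable]].
have [MF'|nMF] := boolP (M \in F); last first.
  exists M; split=> //; first exact/link_vertexP.
  by move=> y yI /(link_vertexP _ XF)[_ /(mM y yI)/andP[_ /ge_comparable]].
have eM : M = m by apply: le1; apply/setIP.
have /andP[mx xM] := mM x xI cxF; case/negP: xF.
by rewrite (_ : x = m) //; apply/le_anti; rewrite mx -{1}eM xM.
Qed.

(** A set is a chain once its elements are pairwise comparable, so the apex of [link_apex] extends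
    every face of the link inside [I]. *)
Lemma acyclic_link_deletion F x : F \in thin X I -> x \in I -> [set x] \in link X F ->
  acyclic k (deletion (link X F) I).
Proof.
move=> TF xI Xx; have [v [vI Xv vy]] := link_apex TF xI Xx.
have XF : F \in X by move: TF; rewrite inE => /andP[].
apply: (acyclic_deletion_cone (gorenstein_star_link XF GX) vI Xv) => G XG sGI.
have [vF cvF] := link_vertexP v XF Xv.
have cL := link_is_complex (order_complex_is_complex P) XF.
move: (XG); rewrite !in_link => /andP[dGF XFG].
rewrite -setI_eq0 setIUl setU_eq0 !setI_eq0 disjoints1 vF dGF /= setUCA.
apply: order_complexU1 => // y /setUP[yF|yG]; first exact: cvF.
by rewrite comparable_sym; apply: vy (subsetP sGI y yG) (face1 cL XG yG).
Qed.

(** [F] already uses up the one vertex in [I] that a thin face may have. *)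
Lemma link_thin_meet F : F \in thin X I -> F :&: I != set0 ->
  link (thin X I) F = deletion (link X F) I.
Proof.
rewrite inE -card_gt0 => /andP[XF leF] gtF; apply/setP => G.
rewrite in_link in_thin in_deletion in_link -andbA; have [dGF|//] := boolP [disjoint G & F].
congr (_ && _); have c1 : #|F :&: I| = 1%N by apply/eqP; rewrite eqn_leq leF.
rewrite setIUl cardsU c1 setIACA (setIC F G).
rewrite (eqP (_ : G :&: F == set0)) ?setI_eq0 // set0I cards0 subn0 -setI_eq0 -cards_eq0.
by rewrite add1n ltnS leqn0.
Qed.

Lemma link_thin_disjoint F : [disjoint F & I] ->
  link (thin X I) F = thin (link X F) I.
Proof.
rewrite -setI_eq0 => /eqP FI; apply/setP => G.
by rewrite in_link !in_thin in_link setIUl FI set0U andbA.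
Qed.

Lemma cohen_macaulay_thin : cohen_macaulay k (thin X I).
Proof.
have cX := order_complex_is_complex P; split; first exact: thin_is_complex.
move=> F TF m ltm; have XF : F \in X by move: TF; rewrite inE => /andP[].
(* When thinning leaves the link unchanged, exactness comes from [X]; in all other cases the link is
   acyclic. *)
have sub (Y : {set {set P}}) : Y \subset link X F -> link X F \subset Y ->
    link (thin X I) F = Y ->
    exact_at k (link (thin X I) F) m.
  move=> s1 s2 e; have E : link (thin X I) F = link X F.
    by rewrite e; apply/eqP; rewrite eqEsubset s1.
  by rewrite E in ltm *; apply: GX.1.2 ltm.
have cL := link_is_complex cX XF.
have [FI|/(link_thin_meet TF) eL] := boolP (F :&: I == set0); last first.
  have [/existsP[x /andP[xI Xx]]|none] := boolP [exists x in I, [set x] \in link X F].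
    by rewrite eL; apply: acyclic_link_deletion TF xI Xx m.
  apply: (sub _ _ _ eL); apply/subsetP => G; rewrite inE; first by case/andP.
  move=> XG; rewrite XG /= disjoints_subset; apply/subsetP => x xG; rewrite inE.
  by apply: contra none => xI; apply/existsP; exists x; rewrite xI (face1 cL XG).
rewrite setI_eq0 in FI; have eL := link_thin_disjoint FI.
pose J := [set x in I | [set x] \in link X F].
have inJ G x : G \in link X F -> x \in G -> x \in I -> x \in J.
  by move=> XG xG xI; rewrite /J inE xI (face1 cL XG xG).
(* With at most one vertex of the link in [I], thinning removes nothing. *)
have [leJ|gtJ] := leqP #|J| 1.
  apply: (sub _ _ _ eL); apply/subsetP => G; rewrite inE; first by case/andP.
  move=> XG; rewrite XG /=; apply: leq_trans leJ; apply: subset_leq_card.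
  by apply/subsetP => x /setIP[xG xI]; apply: inJ XG xG xI.
rewrite eL; apply: acyclic_thin => // [|x xI Xx].
  have /card_gt0P[x] : (0 < #|J|)%N by apply: leq_trans gtJ.
  by case/setIdP => xI Xx; apply: acyclic_link_deletion TF xI Xx.
have [_ eLx] := link_face Xx.
have [xF cxF] := link_vertexP x XF Xx.
have TFx : F :|: [set x] \in thin X I.
  rewrite inE (link_face Xx).1 setIUl (eqP (_ : F :&: I == set0)) ?setI_eq0 // set0U.
  by rewrite (leq_trans (subset_leq_card (subsetIl _ _))) ?cards1.
have [v [vI Xv vP]] := link_apex TF xI Xx.
(* The link of [F :|: [set x]] needs a vertex in [I]: take the apex or, if that is [x], any other
   element of [J]. *)
have [y [yI Xy nyx cyx]] : exists y, [/\ y \in I, [set y] \in link X F, y != x & x >=< y].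
  have [evx|nvx] := eqVneq v x; last by exists v; split=> //; rewrite comparable_sym vP.
  move: gtJ; rewrite (cardsD1 x) inE xI Xx add1n ltnS => /card_gt0P[y].
  by case/setD1P=> nyx /setIdP[yI Xy]; exists y; split=> //; rewrite -evx vP.
rewrite eLx; apply: acyclic_link_deletion TFx yI _.
have [yF cyF] := link_vertexP y XF Xy; apply/link_vertexP; first exact: (link_face Xx).1.
by split=> [|f]; rewrite !inE ?negb_or ?yF // => /orP[/cyF|/eqP->].
Qed.

(** By purity, any maximal chain meeting [I] only in [a] will do. Passing from [a] to a cover not
    below [b] forces this. *)
Lemma card_facets_thin : card_facets (thin X I) = card_facets X.
Proof.
apply/eqP; rewrite eqn_leq; apply/andP; split.
  apply/bigmax_leqP => C; rewrite in_thin => /andP[XC _]; exact: card_facets_ge.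
suff [C TC <-] : exists2 C, C \in thin X I & #|C| = card_facets X.
  exact: card_facets_ge.
have [ab|nab] := boolP (a <= b); last first.
  have [C XC cC] := card_facets_ex (order_complex_is_complex P).
  exists C; rewrite // in_thin XC /= (_ : C :&: I = set0) ?cards0 //.
  apply/setP => x; rewrite !inE; apply/negP => /and3P[_ ax xb].
  by rewrite (le_trans ax xb) in nab.
have nTb : ~~ (\top <= val b) by rewrite lt_geF ?val_lt1.
have [z [/andP[az /forallP no] _ zb]] :=
  exists_cover_notin_below GX (val_lt1 a) ab nTb.
have [C0 [XC0 aC0 C0P]] : exists C0 : {set P}, [/\ C0 \in X, a \in C0 &
    forall t, a < t -> (forall c, c \in C0 -> c >=< t) -> t \notin I].
  (* If the cover is the top of [L], no proper element lies above [a]. *)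
  have [zT|nzT] := eqVneq z \top.
    exists [set a]; split; rewrite ?set11 //.
      by apply/order_complexP => x y /set1P-> /set1P->; rewrite comparablexx.
    by move=> t at_ _; have := no (val t); rewrite zT (val_lt1 t) andbT => /negP[].
  have [||z' ez] := @proper_partP d L z; rewrite ?ltx1 //.
    exact: lt_trans (val_gt0 a) az.
  rewrite -ez in az no zb; exists [set a; z']; split; rewrite ?set21 //.
    apply: order_complexU1 => [|y /set1P->]; last exact: gt_comparable.
    by apply/order_complexP => x y /set1P-> /set1P->; rewrite comparablexx.
  move=> t at_ tC; rewrite inE negb_and; apply/orP; right.
  have /comparable_ltgtP[zt|tz|<- //] : z' >=< t by apply: tC; rewrite !inE eqxx orbT.
    by apply: contra zb => /(le_trans (ltW zt)).
  by have /negP[] := no (val t); apply/andP.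
have [C maxC sC] := maxset_exists (P := [in X]) XC0.
exists C; last exact: cohen_macaulay_facet GX.1 maxC.
have XC := maxsetp maxC; have aC := subsetP sC a aC0.
rewrite in_thin [_ \in _]XC /=; apply: leq_trans (subset_leq_card _) (eq_leq (cards1 a)).
apply/subsetP => t /setIP[tC tI]; rewrite inE; apply: contraLR tI => nta.
have /orP[at_|ta] : a >=< t by move/order_complexP: XC; apply.
  apply: C0P; first by rewrite lt_neqAle eq_sym nta.
  by move=> c /(subsetP sC) cC; move/order_complexP: XC; apply.
rewrite inE negb_and; apply/orP; left; apply: contra nta => at_.
by apply/eqP/le_anti; rewrite ta.
Qed.
End EdgeDeletion.

Theorem theorem1p1 (k : fieldType) (d : Order.disp_t) (L : finTBLatticeType d) :
  Gorenstein_star_lattice k L -> edgewise_strongly_CM k (proper_part L).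
Proof.
move=> GL; have cX := order_complex_is_complex (proper_part L).
have GX := Gorenstein_star_complexW cX GL.
split; first exact: GL.1.
(* The rank is -1 when the proper part is empty. *)
exists ((card_facets (order_complex (proper_part L)))%:Z - 1) => [C maxC|a b].
  by rewrite (cohen_macaulay_facet GX.1 maxC).
have CMT := cohen_macaulay_thin GX a b.
split.
  rewrite /CM_poset (order_complex_ominus GX); apply/CM_complexP => //; exact: CMT.1.
move=> C; rewrite /maximal_chain (order_complex_ominus GX) => maxC.
by rewrite (cohen_macaulay_facet CMT maxC) (card_facets_thin GX).
Qed.
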